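(* Let $n,r\ge 1$ be integers. The set of superspace monomials $\mathcal{A}_{n,r}\subseteq\Omega$ descends to a $\mathbb{C}$-vector space basis of the superspace coinvariant ring $SR_{n,r}=\Omega/SI_{n,r}$ of $\mathbb{Z}_r\wr\mathfrak{S}_n$.
   Context: Write $[n]=\{1,\dots,n\}$ and $\zeta=\exp(2\pi i/r)$. $\mathbb{Z}_r\wr\mathfrak{S}_n$ is the group of $n\times n$ complex monomial matrices (exactly one nonzero entry in each row and column) whose nonzero entries are $r$-th roots of unity. $\Omega=\mathbb{C}[x_1,\dots,x_n]\otimes\wedge\{\theta_1,\dots,\theta_n\}$ is the unital associative $\mathbb{C}$-algebra generated by $x_i,\theta_i$ with relations $x_ix_j=x_jx_i$, $x_i\theta_j=\theta_jx_i$, $\theta_i\theta_j=-\theta_j\theta_i$. The group acts on $\Omega$ by algebra automorphisms: $\mathrm{diag}(\zeta^{c_1},\dots,\zeta^{c_n})$ sends $x_i\mapsto\zeta^{-c_i}x_i$, $\theta_i\mapsto\zeta^{-c_i}\theta_i$, and a permutation matrix $w$ sends $x_i\mapsto x_{w(i)}$, $\theta_i\mapsto\theta_{w(i)}$. $SI_{n,r}\subseteq\Omega$ is the two-sided ideal generated by all $(\mathbb{Z}_r\wr\mathfrak{S}_n)$-invariant elements with vanishing constant term, and $SR_{n,r}:=\Omega/SI_{n,r}$. For $J\subseteq[n]$ let $\theta_J:=\prod_{j\in J}\theta_j$ (product in increasing order). The $(J,r)$-staircase $\mathrm{st}(J,r)=(\mathrm{st}(J,r)_1,\dots,\mathrm{st}(J,r)_n)$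 is defined as follows. Write $[n]-J=\{u_1<\cdots<u_k\}$, $u_0:=0$, $u_{k+1}:=n+1$. Set $\mathrm{st}(J,r)_{u_i}:=ir-1$ for $1\le i\le k$; for $j\in J$, set $\mathrm{st}(J,r)_j:=ir-2$, where $1\le i\le k+1$ is the unique index with $u_{i-1}<j<u_i$. $\mathcal{A}_{n,r}(J,r):=\{x_1^{a_1}\cdots x_n^{a_n}: 0\le a_i\le \mathrm{st}(J,r)_i\text{ for all }i\}$ (empty if some $\mathrm{st}(J,r)_i<0$), and $\mathcal{A}_{n,r}:=\bigsqcup_{J\subseteq[n]}\mathcal{A}_{n,r}(J,r)\cdot\theta_J$. ''Descends to a basis'' means that the images in the quotient form a basis. *)

(* Defs.v *)
From HB Require Import structures.
From mathcomp Require Import all_boot all_order perm all_algebra.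
From mathcomp Require Import mpoly ring.
From mathcomp Require Import boolp reals complex.

Set Implicit Arguments.
Unset Strict Implicit.
Unset Printing Implicit Defensive.

Import GRing.Theory.
Local Open Scope ring_scope.

Section IdealQuotient.
Variables (F : fieldType) (A : algType F) (S : A -> Prop).

(* The two-sided ideal generated by S: finite sums of a * s * b, s in S. *)
Definition ideal_gen (f : A) : Prop :=
  exists t : seq (A * A * A),
    (forall abc, abc \in t -> S abc.1.2) /\
    f = \sum_(abc <- t) abc.1.1 * abc.1.2 * abc.2.

Definition ideal_pred : pred A := fun f => `[< ideal_gen f >].

Lemma ideal_predP f : reflect (ideal_gen f) (f \in ideal_pred).
Proof. exact: asboolP. Qed.

Lemma ideal_pred_mull a f : f \in ideal_pred -> a * f \in ideal_pred.
Proof.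
move=> /ideal_predP[t [tS ->]]; apply/ideal_predP.
exists [seq (a * p.1.1, p.1.2, p.2) | p <- t]; split.
  by move=> _ /mapP[p /tS ? ->].
by rewrite big_map mulr_sumr; apply: eq_bigr => p _ /=; rewrite !mulrA.
Qed.

Lemma ideal_pred_mulr a f : f \in ideal_pred -> f * a \in ideal_pred.
Proof.
move=> /ideal_predP[t [tS ->]]; apply/ideal_predP.
exists [seq (p.1, p.2 * a) | p <- t]; split.
  by move=> _ /mapP[p /tS ? ->].
by rewrite big_map mulr_suml; apply: eq_bigr => p _ /=; rewrite !mulrA.
Qed.

Lemma ideal_pred_zmod_closed : zmod_closed ideal_pred.
Proof.
split=> [|f g fI]; first by apply/ideal_predP; exists [::]; rewrite big_nil.
move=> /(ideal_pred_mull (-1)); rewrite mulN1r.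
move: fI => /ideal_predP[s [sS ->]] /ideal_predP[t [tS ->]].
apply/ideal_predP; exists (s ++ t); rewrite big_cat; split=> // p.
by rewrite mem_cat => /orP[/sS|/tS].
Qed.

HB.instance Definition _ :=
  GRing.isZmodClosed.Build A ideal_pred ideal_pred_zmod_closed.

Lemma ideal_pred_scale (c : F) f : f \in ideal_pred -> c *: f \in ideal_pred.
Proof. by rewrite -mulr_algl; exact: ideal_pred_mull. Qed.

Lemma ideal_pred_gen f : S f -> f \in ideal_pred.
Proof.
move=> Sf; apply/ideal_predP; exists [:: (1, f, 1)].
rewrite big_seq1 /= mul1r mulr1; split=> // p.
by rewrite inE => /eqP->.
Qed.

Definition ideal_quot := Quotient.quot (GRing.ZmodClosed.clone A ideal_pred _).
HB.instance Definition _ := GRing.Zmodule.on ideal_quot.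

Definition ideal_pi (f : A) : ideal_quot := \pi_ideal_quot%qT f.

Definition ideal_repr (q : ideal_quot) : A := repr q.

Lemma ideal_reprK : cancel ideal_repr ideal_pi.
Proof. by move=> q; exact: reprK. Qed.

Lemma ideal_piP f g : reflect (ideal_pi f = ideal_pi g) (f - g \in ideal_pred).
Proof. rewrite Quotient.idealrBE; exact: eqP. Qed.

Lemma ideal_pi_zmod_morphism : zmod_morphism ideal_pi.
Proof. by move=> f g; rewrite /ideal_pi raddfB. Qed.

HB.instance Definition _ :=
  GRing.isZmodMorphism.Build A ideal_quot ideal_pi ideal_pi_zmod_morphism.

Lemma ideal_pi_eq0 f : (ideal_pi f == 0) = (f \in ideal_pred).
Proof. by rewrite -(raddf0 ideal_pi) -[f in RHS]subr0; apply/eqP/ideal_piP. Qed.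

Lemma ideal_reprP f : ideal_repr (ideal_pi f) - f \in ideal_pred.
Proof. by apply/ideal_piP; rewrite ideal_reprK. Qed.

Definition quot_scale (c : F) (q : ideal_quot) := ideal_pi (c *: ideal_repr q).

Lemma quot_scaleE c f : quot_scale c (ideal_pi f) = ideal_pi (c *: f).
Proof.
by apply/ideal_piP; rewrite -scalerBr; apply/ideal_pred_scale/ideal_reprP.
Qed.

Fact quot_scaleA a b q : quot_scale a (quot_scale b q) = quot_scale (a * b) q.
Proof. by rewrite -[q]ideal_reprK !quot_scaleE scalerA. Qed.
Fact quot_scale1 : left_id 1 quot_scale.
Proof. by move=> q; rewrite -[q]ideal_reprK quot_scaleE scale1r. Qed.
Fact quot_scaleDr : right_distributive quot_scale +%R.
Proof.
move=> a p q; rewrite -[p]ideal_reprK -[q]ideal_reprK.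
by rewrite -raddfD !quot_scaleE scalerDr raddfD.
Qed.
Fact quot_scaleDl q : {morph quot_scale^~ q : a b / a + b}.
Proof.
by move=> a b; rewrite -[q]ideal_reprK !quot_scaleE scalerDl raddfD.
Qed.

HB.instance Definition _ := GRing.Zmodule_isLmodule.Build F ideal_quot
  quot_scaleA quot_scale1 quot_scaleDr quot_scaleDl.

Definition quot_mul (p q : ideal_quot) :=
  ideal_pi (ideal_repr p * ideal_repr q).

Lemma quot_mulE f g : quot_mul (ideal_pi f) (ideal_pi g) = ideal_pi (f * g).
Proof.
apply/ideal_piP.
have -> : ideal_repr (ideal_pi f) * ideal_repr (ideal_pi g) - f * g =
    (ideal_repr (ideal_pi f) - f) * ideal_repr (ideal_pi g) +
    f * (ideal_repr (ideal_pi g) - g) by rewrite mulrBl mulrBr addrA subrK.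
by apply: rpredD; [apply: ideal_pred_mulr|apply: ideal_pred_mull];
  exact: ideal_reprP.
Qed.

Fact quot_mulA : associative quot_mul.
Proof.
move=> p q s; rewrite -[p]ideal_reprK -[q]ideal_reprK -[s]ideal_reprK.
by rewrite !quot_mulE mulrA.
Qed.
Fact quot_mul1 : left_id (ideal_pi 1) quot_mul.
Proof. by move=> q; rewrite -[q]ideal_reprK quot_mulE mul1r. Qed.
Fact quot_mulr1 : right_id (ideal_pi 1) quot_mul.
Proof. by move=> q; rewrite -[q]ideal_reprK quot_mulE mulr1. Qed.
Fact quot_mulDl : left_distributive quot_mul +%R.
Proof.
move=> p q s; rewrite -[p]ideal_reprK -[q]ideal_reprK -[s]ideal_reprK.
by rewrite -raddfD !quot_mulE mulrDl raddfD.
Qed.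
Fact quot_mulDr : right_distributive quot_mul +%R.
Proof.
move=> p q s; rewrite -[p]ideal_reprK -[q]ideal_reprK -[s]ideal_reprK.
by rewrite -raddfD !quot_mulE mulrDr raddfD.
Qed.

(* Only a possibly zero ring, since S may generate the unit ideal. *)
HB.instance Definition _ := GRing.Zmodule_isPzRing.Build ideal_quot
  quot_mulA quot_mul1 quot_mulr1 quot_mulDl quot_mulDr.

Lemma ideal_pi_scalable : scalable ideal_pi.
Proof. by move=> c f; rewrite -quot_scaleE. Qed.
HB.instance Definition _ :=
  GRing.isScalable.Build F A ideal_quot *:%R ideal_pi ideal_pi_scalable.

Lemma ideal_pi_monoid_morphism : monoid_morphism ideal_pi.
Proof. by split=> // f g; rewrite -quot_mulE. Qed.
HB.instance Definition _ :=
  GRing.isMonoidMorphism.Build A ideal_quot ideal_pi ideal_pi_monoid_morphism.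

End IdealQuotient.

(* The family (e i)_{i in D} is a basis of V; in particular e is injective
   on D. *)
Definition is_basis (F : fieldType) (V : lmodType F) (I : eqType)
    (D : I -> Prop) (e : I -> V) : Prop :=
  (forall (s : seq I) (c : I -> F),
     uniq s -> (forall i, i \in s -> D i) ->
     \sum_(i <- s) c i *: e i = 0 -> forall i, i \in s -> c i = 0) /\
  (forall v : V, exists (s : seq I) (c : I -> F),
     (forall i, i \in s -> D i) /\ v = \sum_(i <- s) c i *: e i).

(* F[x_1..x_n] (x) /\{theta_1..theta_n}: f stands for
   \sum_J f J * theta_J, where theta_J is the increasing product of the
   theta_j, j in J; see superspaceE. *)
Definition superspace (n : nat) (F : fieldType) :=
  {ffun {set 'I_n} -> {mpoly F[n]}}.

Section Superspace.
Variables (n : nat) (F : fieldType).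
Local Notation Omega := (superspace n F).
Implicit Types (f g h : Omega) (J K L M : {set 'I_n}).

HB.instance Definition _ :=
  GRing.Lmodule.copy Omega {ffun {set 'I_n} -> {mpoly F[n]}}.

(* theta_K * theta_L = (-1) ^ (ninv K L) * theta_(K :|: L) when K and L are
   disjoint. *)
Definition ninv K L : nat :=
  (\sum_(k in K) \sum_(l in L) (l < k)%N)%N.

Definition ss_mul f g : Omega :=
  [ffun J : {set 'I_n} => \sum_(K : {set 'I_n} | K \subset J)
     (-1) ^+ ninv K (J :\: K) * f K * g (J :\: K)].

Definition ss_poly (p : {mpoly F[n]}) : Omega :=
  [ffun J : {set 'I_n} => if J == set0 then p else 0].

Lemma ninvUl K L M : [disjoint K & L] ->
  ninv (K :|: L) M = (ninv K M + ninv L M)%N.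
Proof.
by move=> dKL; rewrite /ninv -bigU //; apply: eq_bigl => k; rewrite inE.
Qed.

Lemma ninvUr K L M : [disjoint L & M] ->
  ninv K (L :|: M) = (ninv K L + ninv K M)%N.
Proof.
move=> dLM; rewrite -big_split; apply: eq_bigr => k _ /=.
by rewrite -bigU //; apply: eq_bigl => l; rewrite inE.
Qed.

Lemma ninv0l K : ninv set0 K = 0%N.
Proof. by rewrite /ninv big_set0. Qed.

Lemma ninv0r K : ninv K set0 = 0%N.
Proof. by rewrite /ninv big1 // => k _; rewrite big_set0. Qed.

Fact ss_mulA : associative ss_mul.
Proof.
move=> f g h; apply/ffunP=> J; rewrite !ffunE.
under eq_bigr => K _ do rewrite ffunE mulr_sumr.
under [RHS]eq_bigr => P _ do rewrite ffunE mulr_sumr mulr_suml.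
rewrite [RHS](exchange_big_dep (fun K : {set 'I_n} => K \subset J)) /=; last first.
  by move=> P K PJ KP; exact: subset_trans PJ.
apply: eq_bigr => K KJ.
rewrite [RHS](reindex_onto (setU K) (fun P => P :\: K)) /=; last first.
  move=> P /andP[_ /subsetP KP]; apply/setP=> x; have := KP x.
  by rewrite !inE; case: (x \in K) => //= ->.
apply: eq_big => [M|M MJ].
  rewrite subUset KJ subsetUl andbT /= subsetD setDUl setDv set0U.
  by congr (_ && _); apply/setDidPl/eqP.
have [MsJ dMK] : M \subset J /\ [disjoint M & K].
  by apply/andP; rewrite -subsetD.
have defM : (K :|: M) :\: K = M.
  by rewrite setDUl setDv set0U; apply/setDidPl.
have -> : J :\: (K :|: M) = J :\: K :\: M by rewrite setDDl.
set N := J :\: K :\: M.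
have defJK : J :\: K = M :|: N.
  by apply/setP=> x; have /subsetP/(_ x) := MJ; rewrite !inE;
    case: (x \in M) => //= ->.
have dKM : [disjoint K & M] by rewrite disjoint_sym.
have dMN : [disjoint M & N].
  by rewrite disjoint_sym disjoints_subset /N setDE subsetIr.
rewrite defM defJK ninvUr // ninvUl // !exprD; ring.
Qed.

Fact ss_mul1 : left_id (ss_poly 1) ss_mul.
Proof.
move=> f; apply/ffunP=> J; rewrite ffunE (bigD1 set0) ?sub0set //=.
rewrite !ffunE eqxx ninv0l expr0 !mul1r setD0 big1 ?addr0 // => K /andP[_ K0].
by rewrite ffunE (negPf K0) mulr0 mul0r.
Qed.

Fact ss_mulr1 : right_id (ss_poly 1) ss_mul.
Proof.
move=> f; apply/ffunP=> J; rewrite ffunE (bigD1 J) //=.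
rewrite !ffunE setDv eqxx ninv0r expr0 !mul1r mulr1 big1 ?addr0 //.
move=> K /andP[KJ nKJ]; rewrite ffunE setD_eq0 ifN ?mulr0 //.
by apply: contra nKJ => JK; rewrite eqEsubset KJ.
Qed.

Fact ss_mulDl : left_distributive ss_mul +%R.
Proof.
move=> f g h; apply/ffunP=> J; rewrite !ffunE -big_split.
by apply: eq_bigr => K _; rewrite !ffunE mulrDr mulrDl.
Qed.

Fact ss_mulDr : right_distributive ss_mul +%R.
Proof.
move=> f g h; apply/ffunP=> J; rewrite !ffunE -big_split.
by apply: eq_bigr => K _; rewrite !ffunE mulrDr.
Qed.

Fact ss_oner_neq0 : ss_poly 1 != 0.
Proof.
by apply/eqP=> /ffunP/(_ set0); rewrite !ffunE eqxx; apply/eqP/oner_neq0.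
Qed.

HB.instance Definition _ := GRing.Zmodule_isNzRing.Build Omega
  ss_mulA ss_mul1 ss_mulr1 ss_mulDl ss_mulDr ss_oner_neq0.

Fact ss_scaleAl (c : F) f g : c *: (f * g) = (c *: f) * g.
Proof.
apply/ffunP=> J; rewrite !ffunE scaler_sumr; apply: eq_bigr => K _.
by rewrite ffunE -scalerAr -scalerAl.
Qed.
HB.instance Definition _ := GRing.Lmodule_isLalgebra.Build F Omega ss_scaleAl.

Fact ss_scaleAr (c : F) f g : c *: (f * g) = f * (c *: g).
Proof.
apply/ffunP=> J; rewrite !ffunE scaler_sumr; apply: eq_bigr => K _.
by rewrite ffunE -scalerAr.
Qed.
HB.instance Definition _ := GRing.Lalgebra_isAlgebra.Build F Omega ss_scaleAr.

End Superspace.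

Section AlternatingProduct.
Variables (n : nat) (B : nzRingType) (T : 'I_n -> B).
Hypotheses (TC : forall i j, T i * T j = - (T j * T i))
           (T2 : forall i, T i * T i = 0).
Implicit Types (i j k : 'I_n) (s t : seq 'I_n) (K L : {set 'I_n}).

Let lt : rel 'I_n := relpre val ltn.
Let P s := \prod_(j <- s) T j.

Let lt_trans : transitive lt.
Proof. by move=> j i k; exact: ltn_trans. Qed.

Let lt_irr : irreflexive lt.
Proof. by move=> i; exact: ltnn. Qed.

Let sorted_enum K : sorted lt (enum K).
Proof.
rewrite /enum_mem; apply: sorted_filter => //.
by rewrite -enumT /lt -sorted_map val_enum_ord iota_ltn_sorted.
Qed.

Let sortedE s K : sorted lt s -> s =i K -> s = enum K.
Proof.
move=> s_sort sK; apply: (irr_sorted_eq lt_trans lt_irr) => // x.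
by rewrite sK mem_enum.
Qed.

Let mulT_mem i s : i \in s -> T i * P s = 0.
Proof.
rewrite /P; elim: s => // j s IHs; rewrite inE big_cons mulrA.
case: eqP => [->|_ /= /IHs is0]; first by rewrite T2 mul0r.
by rewrite TC mulNr -mulrA is0 mulr0 oppr0.
Qed.

Let mulT_notin i s : sorted lt s -> i \notin s ->
  T i * P s =
    (-1) ^+ count (fun l => lt l i) s * P (enum [set x in i :: s]).
Proof.
elim: s => [_ _|j s IHs js_sort].
  rewrite -(@sortedE [:: i]) // => [|x]; last by rewrite !inE.
  by rewrite /= expr0 mul1r /P big_nil big_seq1 mulr1.
rewrite inE negb_or => /andP[ij nis].
have s_sort : sorted lt s := path_sorted js_sort.
have js : all (lt j) s by move: js_sort; rewrite /= (path_sortedE lt_trans) => /andP[].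
case: (ltngtP i j) => [lt_ij|lt_ji|/val_inj eq_ij]; last by rewrite eq_ij eqxx in ij.
- have ijs : sorted lt [:: i, j & s] by rewrite /= /lt /= lt_ij.
  rewrite -(@sortedE [:: i, j & s]) //; last by move=> x; rewrite !inE.
  rewrite (_ : count _ _ = 0%N) ?mul1r /P ?big_cons //.
  apply/eqP; rewrite -leqn0 leqNgt -has_count; apply/hasPn => x.
  rewrite inE /lt /= -leqNgt => /predU1P[->|/(allP js) jx]; first exact: ltnW.
  exact: ltnW (ltn_trans lt_ij jx).
have -> : enum [set x in [:: i, j & s]] = j :: enum [set x in i :: s].
  symmetry; apply: sortedE => [|x].
    rewrite /= (path_sortedE lt_trans) sorted_enum andbT; apply/allP => x.
    by rewrite mem_enum !inE => /predU1P[-> //|/(allP js)].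
  by rewrite !inE mem_enum !inE orbCA.
rewrite /P !big_cons /= mulrA TC mulNr -mulrA [T i * _]IHs //.
rewrite {2}/lt /= lt_ji add1n exprS mulN1r mulNr; congr (- _).
by rewrite !mulrA commr_sign.
Qed.

Lemma alt_prodM K L :
  (\prod_(k <- enum K) T k) * (\prod_(l <- enum L) T l) =
  if [disjoint K & L]
  then (-1) ^+ ninv K L * \prod_(j <- enum (K :|: L)) T j else 0.
Proof.
rewrite -![\prod_(j <- _) _]/(P _).
have -> : ninv K L = (\sum_(k <- enum K) \sum_(l in L) (l < k))%N.
  by rewrite /ninv big_enum.
have -> : [disjoint K & L] = ~~ has (fun x => x \in L) (enum K).
  rewrite -[LHS]negbK; congr (~~ _); apply/idP/idP.
    by case/pred0Pn=> x /andP[xK xL]; apply/hasP; exists x; rewrite ?mem_enum.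
  by case/hasP=> x; rewrite mem_enum => xK xL; apply/pred0Pn; exists x; apply/andP.
have -> : K :|: L = [set x in enum K] :|: L.
  by congr (_ :|: _); apply/setP=> x; rewrite inE mem_enum.
elim: (enum K) (sorted_enum K) => [_|k s IHs ks_sort].
  have -> : [set x in [::]] = set0 :> {set 'I_n} by apply/setP=> x; rewrite !inE.
  by rewrite big_nil /= set0U /P big_nil !mul1r.
have s_sort : sorted lt s := path_sorted ks_sort.
have ks : all (lt k) s by move: ks_sort; rewrite /= (path_sortedE lt_trans) => /andP[].
rewrite [P (k :: s)]big_cons -mulrA [_ * P (enum L)]IHs //= negb_or.
case: ifP; rewrite ?(andbF, andbT) ?mulr0 // => sL.
rewrite mulrA commr_sign -mulrA.
have [kL|nkL] := boolP (k \in L).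
  by rewrite mulT_mem ?mulr0 // mem_enum inE kL orbT.
have nks : k \notin s by apply/negP=> /(allP ks); rewrite lt_irr.
rewrite mulT_notin ?sorted_enum //; last by rewrite mem_enum !inE negb_or nks.
rewrite mulrA -exprD big_cons addnC; congr (_ ^+ (_ + _) * P _).
  rewrite -sum1_count big_mkcond big_enum /=.
  rewrite [RHS]big_mkcond [LHS]big_mkcond; apply: eq_bigr => l _.
  rewrite !inE; case: (boolP (l \in s)) => [/(allP ks) kl|_] /=; last first.
    by case: (l \in L) => //; rewrite /lt /=; case: ltnP.
  rewrite /lt /= in kl *; rewrite ltnNge (ltnW kl) /=.
  by case: ifP.
apply: eq_enum => x; rewrite !inE mem_enum !inE.
by rewrite orbA.
Qed.

End AlternatingProduct.

Section Generators.
Variables (n : nat) (F : fieldType).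
Local Notation Omega := (superspace n F).
Implicit Types (f g h : Omega) (J K L M : {set 'I_n}).

Definition ss_x (i : 'I_n) : Omega := ss_poly 'X_i.

Definition ss_theta (i : 'I_n) : Omega :=
  [ffun J : {set 'I_n} => (J == [set i])%:R].

Definition ss_thetas (J : {set 'I_n}) : Omega :=
  \prod_(j <- enum J) ss_theta j.

Lemma ss_mulE f g J : (f * g) J =
  \sum_(K : {set 'I_n} | K \subset J)
     (-1) ^+ ninv K (J :\: K) * f K * g (J :\: K).
Proof. by rewrite ffunE. Qed.

Lemma ss_poly_mulE p f J : (ss_poly p * f) J = p * f J.
Proof.
rewrite ss_mulE (bigD1 set0) ?sub0set //= ffunE eqxx ninv0l mul1r setD0.
rewrite big1 ?addr0 // => K /andP[_ /negPf K0].
by rewrite ffunE K0 mulr0 mul0r.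
Qed.

Lemma ss_poly_comm p f : ss_poly p * f = f * ss_poly p.
Proof.
apply/ffunP=> J; rewrite ss_poly_mulE ss_mulE (bigD1 J) //= ffunE setDv eqxx.
rewrite ninv0r mul1r mulrC big1 ?addr0 // => K /andP[KJ nKJ].
rewrite ffunE setD_eq0 ifN ?mulr0 //.
by apply: contra nKJ => JK; rewrite eqEsubset KJ.
Qed.

Lemma ss_poly_linear : linear (@ss_poly n F).
Proof.
move=> c p q; apply/ffunP=> J; rewrite !ffunE.
by case: eqP; rewrite ?scaler0 ?addr0.
Qed.
HB.instance Definition _ :=
  GRing.isLinear.Build F {mpoly F[n]} Omega *:%R (@ss_poly n F) ss_poly_linear.

Lemma ss_poly_monoid_morphism : monoid_morphism (@ss_poly n F).
Proof.
split=> // p q; apply/ffunP=> J; rewrite ss_poly_mulE !ffunE.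
by case: eqP; rewrite ?mulr0.
Qed.
HB.instance Definition _ := GRing.isMonoidMorphism.Build
  {mpoly F[n]} Omega (@ss_poly n F) ss_poly_monoid_morphism.

Let delta J : Omega := [ffun K : {set 'I_n} => (K == J)%:R].

Let deltaE K f J : (delta K * f) J =
  if K \subset J then (-1) ^+ ninv K (J :\: K) * f (J :\: K) else 0.
Proof.
rewrite ss_mulE; case: ifP => KJ.
  rewrite (bigD1 K) //= ffunE eqxx mulr1 big1 ?addr0 // => M /andP[_ /negPf MK].
  by rewrite ffunE MK mulr0 mul0r.
rewrite big1 // => M MJ; rewrite ffunE.
by case: eqP => [eMK|_]; [rewrite -eMK MJ in KJ | rewrite mulr0 mul0r].
Qed.

Let deltaM K L : [disjoint K & L] ->
  delta K * delta L = (-1) ^+ ninv K L *: delta (K :|: L).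
Proof.
move=> dKL; apply/ffunP=> J; rewrite deltaE !ffunE.
have [->|nJ] := eqVneq J (K :|: L).
  rewrite subsetUl setDUl setDv set0U.
  have -> : L :\: K = L by apply/setDidPl; rewrite disjoint_sym.
  rewrite eqxx mulr1 -[in LHS]signr_odd -[in RHS]signr_odd.
  by case: odd; rewrite ?expr0 ?scale1r ?expr1 ?scaleN1r.
case: ifP => KJ; last by rewrite scaler0.
rewrite (_ : _ == L = false) ?mulr0 ?scaler0 //.
apply: contraNF nJ => /eqP <-.
by apply/eqP/setP=> x; have /subsetP/(_ x) := KJ; rewrite !inE;
  case: (x \in K) => //= ->.
Qed.

Let delta_theta i : ss_theta i = delta [set i]. Proof. by []. Qed.

Let deltaM0 K L : ~~ [disjoint K & L] -> delta K * delta L = 0.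
Proof.
move=> nKL; apply/ffunP=> J; rewrite deltaE !ffunE; case: ifP => // KJ.
rewrite (_ : _ == L = false) ?mulr0 //; apply: contraNF nKL => /eqP <-.
by rewrite disjoint_sym disjoints_subset setDE subsetIr.
Qed.

Lemma ss_thetaC i j : ss_theta i * ss_theta j = - (ss_theta j * ss_theta i).
Proof.
have [->|nij] := eqVneq i j.
  by rewrite !delta_theta deltaM0 ?oppr0 // disjoints1 set11.
rewrite !delta_theta !deltaM ?disjoints1 ?inE // 1?eq_sym //.
rewrite [[set j] :|: _]setUC -scaleNr /ninv !big_set1; congr (_ *: _).
rewrite -val_eqE neq_ltn in nij.
by case: ltngtP nij => //= _ _; rewrite ?expr0 ?expr1 ?opprK.
Qed.

Lemma ss_theta_sqr i : ss_theta i * ss_theta i = 0.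
Proof. by rewrite !delta_theta deltaM0 // disjoints1 set11. Qed.

Lemma ss_thetasE J : ss_thetas J = [ffun K : {set 'I_n} => (K == J)%:R].
Proof.
rewrite -/(delta J) /ss_thetas.
have: sorted ltn (map val (enum J)).
  rewrite sorted_map /enum_mem; apply: sorted_filter.
    by move=> ? ? ?; exact: ltn_trans.
  by rewrite -enumT -sorted_map val_enum_ord iota_ltn_sorted.
have -> : delta J = delta [set x in enum J].
  by congr delta; apply/setP=> x; rewrite inE mem_enum.
elim: (enum J) => [_|k s IHs /= ks_sort].
  rewrite big_nil; apply/ffunP=> K; rewrite !ffunE.
  have -> : [set x in [::]] = set0 :> {set 'I_n} by apply/setP=> x; rewrite !inE.
  by case: eqP.
rewrite big_cons {}IHs ?(path_sorted ks_sort) // delta_theta.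
move: ks_sort; rewrite (path_sortedE ltn_trans) all_map => /andP[/allP ks _].
have -> : [set x in k :: s] = [set k] :|: [set x in s].
  by apply/setP=> x; rewrite !inE.
rewrite deltaM; last first.
  by rewrite disjoints1 inE; apply/negP=> /ks; rewrite /= ltnn.
rewrite /ninv big_set1 big1 ?scale1r // => l; rewrite inE => /ks /= kl.
by rewrite ltnNge (ltnW kl).
Qed.

Lemma superspaceE f : f = \sum_(J : {set 'I_n}) ss_poly (f J) * ss_thetas J.
Proof.
apply/ffunP=> K; rewrite sum_ffunE (bigD1 K) //= ss_poly_mulE ss_thetasE ffunE.
rewrite eqxx mulr1 big1 ?addr0 // => J /negPf nJK.
by rewrite ss_poly_mulE ss_thetasE ffunE eq_sym nJK mulr0.
Qed.

(* The algebra endomorphism of Omega induced by the contragredient action of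
   g on the span of the x_j (resp. theta_j); see act_diag and act_perm. *)
Definition act_x (g : 'M[F]_n) (j : 'I_n) : {mpoly F[n]} :=
  \sum_i invmx g j i *: 'X_i.

Definition act_theta (g : 'M[F]_n) (j : 'I_n) : Omega :=
  \sum_i invmx g j i *: ss_theta i.

Definition act (g : 'M[F]_n) (f : Omega) : Omega :=
  \sum_(J : {set 'I_n})
    ss_poly (f J \mPo [tuple act_x g j | j < n]) *
    \prod_(j <- enum J) act_theta g j.

End Generators.

Section Action.
Variables (n : nat) (F : fieldType).
Local Notation Omega := (superspace n F).
Implicit Types (f h : Omega) (J K L : {set 'I_n}) (g : 'M[F]_n).

Lemma act_thetaC g i j :
  act_theta g i * act_theta g j = - (act_theta g j * act_theta g i).
Proof.
rewrite /act_theta mulr_suml [in RHS]mulr_sumr -sumrN.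
apply: eq_bigr => k _; rewrite mulr_sumr mulr_suml -sumrN.
apply: eq_bigr => l _; rewrite -!scalerAl -!scalerAr ss_thetaC !scalerN.
by rewrite !scalerA mulrC.
Qed.

Lemma act_theta_sqr g i : act_theta g i * act_theta g i = 0.
Proof.
rewrite /act_theta mulr_suml.
under eq_bigr => k _ do rewrite mulr_sumr (bigID (fun l : 'I_n => (l < k)%N)) /=.
rewrite big_split /= [X in _ + X](_ : _ =
  - \sum_(k < n) \sum_(l < n | (l < k)%N)
      invmx g i k *: ss_theta F k * (invmx g i l *: ss_theta F l)) ?subrr //.
rewrite -sumrN; under [RHS]eq_bigr => k _ do rewrite -sumrN.
rewrite [RHS](exchange_big_dep predT) //=; apply: eq_bigr => k _.
rewrite (bigD1 k) /= ?ltnn // -scalerAl -scalerAr ss_theta_sqr !scaler0 add0r.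
apply: eq_big => [l|l _]; first by rewrite -leqNgt ltn_neqAle andbC eq_sym.
rewrite -!scalerAl -!scalerAr [in RHS]ss_thetaC !scalerN opprK.
by rewrite !scalerA mulrC.
Qed.

Lemma act_linear g : linear (act g : Omega -> Omega).
Proof.
move=> c f h; rewrite /act scaler_sumr -big_split; apply: eq_bigr => J _ /=.
by rewrite !ffunE !linearP /= mulrDl scalerAl.
Qed.
HB.instance Definition _ g :=
  GRing.isLinear.Build F Omega Omega *:%R (act g) (act_linear g).

Lemma act_poly_thetas g (p : {mpoly F[n]}) J :
  act g (ss_poly p * ss_thetas F J) =
  ss_poly (p \mPo [tuple act_x g j | j < n]) *
    \prod_(j <- enum J) act_theta g j.
Proof.
rewrite /act (bigD1 J) //= ss_poly_mulE ss_thetasE ffunE eqxx [p * _]mulr1.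
rewrite [X in _ + X]big1 ?addr0 // => K /negPf nKJ.
by rewrite ss_poly_mulE ffunE nKJ mulr0 comp_mpoly0 raddf0 mul0r.
Qed.

Lemma act_poly g (p : {mpoly F[n]}) :
  act g (ss_poly p) = ss_poly (p \mPo [tuple act_x g j | j < n]).
Proof.
have := act_poly_thetas g p set0.
by rewrite /ss_thetas enum_set0 !big_nil !mulr1.
Qed.

Lemma act_monoid_morphism g : monoid_morphism (act g : Omega -> Omega).
Proof.
split=> [|f h].
  have -> : 1 = ss_poly 1 :> Omega by [].
  by rewrite act_poly comp_mpoly1.
rewrite [act g f]/act [act g h]/act mulr_suml.
under [RHS]eq_bigr => K _ do rewrite mulr_sumr.
transitivity (\sum_(K : {set 'I_n}) \sum_(J : {set 'I_n} | K \subset J)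
  ss_poly (((-1) ^+ ninv K (J :\: K) * f K * h (J :\: K))
     \mPo [tuple act_x g j | j < n]) * \prod_(j <- enum J) act_theta g j).
  rewrite [RHS](exchange_big_dep predT) //=; apply: eq_bigr => J _.
  by rewrite ss_mulE (raddf_sum (comp_mpoly _)) raddf_sum /= mulr_suml.
apply: eq_bigr => K _.
rewrite (reindex_onto (setU K) (fun J => J :\: K)) /=; last first.
  move=> P /subsetP KP; apply/setP=> x; have := KP x.
  by rewrite !inE; case: (x \in K) => //= ->.
rewrite big_mkcond; apply: eq_bigr => L _ /=.
rewrite subsetUl /= setDUl setDv set0U.
have swap (p q : {mpoly F[n]}) (t u : Omega) :
    ss_poly p * t * (ss_poly q * u) = ss_poly p * ss_poly q * (t * u).
  by rewrite -!mulrA; congr (_ * _); rewrite !mulrA ss_poly_comm.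
rewrite swap alt_prodM; [|exact: act_thetaC|exact: act_theta_sqr].
rewrite disjoint_sym; case: (boolP [disjoint L & K]) => [dLK|nLK]; last first.
  by case: eqP => [/setDidPl dLK|_]; [rewrite dLK in nLK | rewrite !mulr0].
have -> : L :\: K = L by apply/setDidPl.
rewrite eqxx !(rmorphM (comp_mpoly _)) (rmorph_sign (comp_mpoly _)).
rewrite !rmorphM rmorph_sign /= [RHS]mulrA.
by rewrite [X in _ = X * _]commr_sign !mulrA.
Qed.
HB.instance Definition _ g :=
  GRing.isMonoidMorphism.Build Omega Omega (act g) (act_monoid_morphism g).

Lemma act_xE g j : act g (ss_x F j) = \sum_i invmx g j i *: ss_x F i.
Proof.
rewrite act_poly comp_mpolyXU -tnth_nth tnth_mktuple (raddf_sum (@ss_poly n F)).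
by apply: eq_bigr => i _; rewrite /= -[in RHS]linearZ.
Qed.

Lemma act_thetaE g j :
  act g (ss_theta F j) = \sum_i invmx g j i *: ss_theta F i.
Proof.
have := act_poly_thetas g 1 [set j].
by rewrite /ss_thetas enum_set1 !big_seq1 !(raddf0, rmorph1, mul1r).
Qed.

End Action.

Section ActionGroup.
Variables (n : nat) (F : fieldType).
Local Notation Omega := (superspace n F).
Implicit Types (f : Omega) (g h : 'M[F]_n).

Let invmxE g h : g *m h = 1%:M -> invmx g = h.
Proof.
by move=> gh; have [ug _] := mulmx1_unit gh; rewrite -[LHS]mulmx1 -gh mulKmx.
Qed.

Lemma act_diag (d : 'rV[F]_n) i : (forall j, d 0 j != 0) ->
  act (diag_mx d) (ss_x F i) = (d 0 i)^-1 *: ss_x F i /\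
  act (diag_mx d) (ss_theta F i) = (d 0 i)^-1 *: ss_theta F i.
Proof.
move=> d0; rewrite act_xE act_thetaE.
rewrite (@invmxE _ (diag_mx (\row_j (d 0 j)^-1))); last first.
  by apply/matrixP=> j k; rewrite mul_diag_mx !mxE; case: eqP => [->|_];
    rewrite ?mulr1n ?mulfV ?mulr0n ?mulr0.
split; rewrite (bigD1 i) //= !mxE eqxx mulr1n big1 ?addr0 // => j nji;
  by rewrite !mxE eq_sym (negPf nji) mulr0n scale0r.
Qed.

(* perm_mx acts on row vectors; the permutation matrix sending the column
   e_j to e_(w j) is its transpose. *)
Lemma act_perm (w : 'S_n) i :
  act (perm_mx w)^T (ss_x F i) = ss_x F (w i) /\
  act (perm_mx w)^T (ss_theta F i) = ss_theta F (w i).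
Proof.
rewrite act_xE act_thetaE (@invmxE _ (perm_mx w)); last first.
  by rewrite tr_perm_mx -perm_mxM fingroup.mulVg perm_mx1.
split; rewrite (bigD1 (w i)) //= !mxE eqxx scale1r big1 ?addr0 // => j nj;
  by rewrite !mxE eq_sym (negPf nj) scale0r.
Qed.

Lemma act1 f : act 1%:M f = f.
Proof.
have e1 : invmx (1%:M : 'M[F]_n) = 1%:M by apply: invmxE; rewrite mulmx1.
rewrite [RHS]superspaceE /act; apply: eq_bigr => J _.
congr (ss_poly _ * _); last first.
  apply: eq_bigr => j _; rewrite /act_theta e1 (bigD1 j) //= !mxE eqxx scale1r.
  by rewrite big1 ?addr0 // => i nij; rewrite !mxE eq_sym (negPf nij) scale0r.
rewrite -[RHS]comp_mpoly_id; congr (_ \mPo _).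
apply: eq_mktuple => j; rewrite /act_x e1 (bigD1 j) //= !mxE eqxx scale1r.
by rewrite big1 ?addr0 // => i nij; rewrite !mxE eq_sym (negPf nij) scale0r.
Qed.

Lemma act_mul g h f : g \in unitmx -> h \in unitmx ->
  act (g *m h) f = act g (act h f).
Proof.
move=> ug uh.
have egh : invmx (g *m h) = invmx h *m invmx g.
  by apply: invmxE; rewrite mulmxA mulmxK // mulmxV.
rewrite [f]superspaceE (linear_sum (act (g *m h))) (linear_sum (act h)).
rewrite (linear_sum (act g)); apply: eq_bigr => J _ /=.
rewrite (rmorphM (act (g *m h))) (rmorphM (act h)) (rmorphM (act g)) /=.
congr (_ * _); last first.
  rewrite /ss_thetas (rmorph_prod (act (g *m h))) (rmorph_prod (act h)) /=.
  rewrite (rmorph_prod (act g)); apply: eq_bigr => j _.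
  rewrite /= !act_thetaE (linear_sum (act g)) egh.
  under [RHS]eq_bigr => k _ do rewrite linearZ /= act_thetaE scaler_sumr.
  rewrite exchange_big; apply: eq_bigr => i _ /=.
  rewrite mxE scaler_suml; apply: eq_bigr => k _.
  by rewrite scalerA.
rewrite !act_poly; congr ss_poly; move: (f J) => p.
set lgh := [tuple act_x (g *m h) j | j < n].
set lg := [tuple act_x g j | j < n]; set lh := [tuple act_x h j | j < n].
rewrite [in RHS](comp_mpolyEX p lh) (comp_mpolyEX p lgh).
rewrite (raddf_sum (comp_mpoly lg)); apply: eq_bigr => m _ /=.
rewrite comp_mpolyZ; congr (_ *: _).
rewrite !comp_mpolyX (rmorph_prod (comp_mpoly lg)); apply: eq_bigr => j _ /=.
rewrite (rmorphXn (comp_mpoly lg)) /=; congr (_ ^+ _).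
rewrite !tnth_mktuple /act_x (raddf_sum (comp_mpoly lg)) egh /=.
under [RHS]eq_bigr => k _ do
  rewrite comp_mpolyZ comp_mpolyXU -tnth_nth tnth_mktuple /act_x scaler_sumr.
rewrite exchange_big; apply: eq_bigr => i _ /=.
by rewrite mxE scaler_suml; apply: eq_bigr => k _; rewrite scalerA.
Qed.

End ActionGroup.

(* Z_r wr S_n inside GL_n(F): monomial matrices whose nonzero entries are r-th
   roots of unity. *)
Definition in_wreath (F : fieldType) (n r : nat) (g : 'M[F]_n) : Prop :=
  [/\ forall i, #|[set j | g i j != 0]| = 1%N,
      forall j, #|[set i | g i j != 0]| = 1%N
    & forall i j, g i j != 0 -> g i j ^+ r = 1].

Definition positive_invariant (n r : nat) (F : fieldType)
    (f : superspace n F) : Prop :=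
  (forall g : 'M[F]_n, in_wreath r g -> act g f = f) /\ (f set0)@_0%MM = 0.

(* The superspace coinvariant ring Omega / SI_{n,r}. *)
Definition SR (n r : nat) (F : fieldType) :=
  ideal_quot (@positive_invariant n r F).
HB.instance Definition _ (n r : nat) (F : fieldType) :=
  GRing.Lmodule.on (SR n r F).
HB.instance Definition _ (n r : nat) (F : fieldType) :=
  GRing.PzRing.on (SR n r F).

Definition SR_pi (n r : nat) (F : fieldType) (f : superspace n F) : SR n r F :=
  ideal_pi _ f.

(* Indices are 0-based: p : 'I_n stands for p.+1.  The index i with p = u_i,
   resp. u_(i-1) < p < u_i, is one more than the number of u < p outside J. *)
Definition staircase (n r : nat) (J : {set 'I_n}) (p : 'I_n) : int :=
  let i := #|[set u in ~: J | (u < p)%N]|.+1 in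
  if p \in J then (i * r)%N%:Z - 2 else (i * r)%N%:Z - 1.

Definition superspace_monomials (n r : nat) (F : fieldType)
    (f : superspace n F) : Prop :=
  exists (J : {set 'I_n}) (m : 'X_{1..n}),
    (forall p : 'I_n, (m p)%:Z <= staircase r J p) /\
    f = ss_poly 'X_[m] * ss_thetas F J.

Section StaircaseSpec.
Variables (n r : nat) (J : {set 'I_n}).
Let u := enum (~: J).

Let below (p : 'I_n) (i : nat) : (i <= size u)%N ->
    (forall a, (a < i)%N -> (nth p u a < p)%N) ->
    (forall a, (i <= a < size u)%N -> (p <= nth p u a)%N) ->
  #|[set v in ~: J | (v < p)%N]| = i.
Proof.
move=> iu lo hi.
have -> : #|[set v in ~: J | (v < p)%N]| = count (fun v : 'I_n => (v < p)%N) u.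
  rewrite -sum1_card -sum1_count [RHS]big_enum_cond /=.
  by apply: eq_bigl => v; rewrite inE.
rewrite -[in LHS](cat_take_drop i u) count_cat.
have -> : count (fun v : 'I_n => (v < p)%N) (drop i u) = 0%N.
  apply/eqP; rewrite -leqn0 leqNgt -has_count; apply/hasPn => v.
  move=> /(nthP p)[a]; rewrite size_drop nth_drop => ha <-.
  by rewrite -leqNgt hi // leq_addr /= -ltn_subRL.
rewrite addn0 -[RHS](size_takel iu); apply/eqP; rewrite -all_count.
apply/allP => v /(nthP p)[a]; rewrite size_takel // => ai <-.
by rewrite nth_take // lo.
Qed.

Let nth_u_lt p a b : (a < b < size u)%N -> (nth p u a < nth p u b)%N.
Proof.
have: sorted ltn (map val u).
  rewrite sorted_map /u /enum_mem; apply: sorted_filter.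
    by move=> ? ? ?; exact: ltn_trans.
  by rewrite -enumT -sorted_map val_enum_ord iota_ltn_sorted.
move=> us /andP[ab bu]; have au := ltn_trans ab bu.
rewrite -!(nth_map p 0%N) //.
by apply: (sorted_ltn_nth ltn_trans) => //; rewrite inE size_map.
Qed.

(* st(J,r)_{u_i} = i r - 1, the list u being 0-based. *)
Lemma staircase_notin p0 i : (i < size u)%N ->
  staircase r J (nth p0 u i) = (i.+1 * r)%N%:Z - 1.
Proof.
move=> iu; rewrite /staircase (_ : _ \in J = false); last first.
  by have := mem_nth p0 iu; rewrite mem_enum inE => /negPf.
rewrite (@below _ i) ?(ltnW iu) // => a.
  by move=> ai; rewrite (set_nth_default p0) ?(ltn_trans ai) // nth_u_lt // ai.
move=> /andP[]; rewrite leq_eqVlt => /predU1P[<- _|ia au].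
  by rewrite (set_nth_default p0).
by rewrite (set_nth_default p0) // ltnW // nth_u_lt // ia.
Qed.

(* st(J,r)_j = (i+1) r - 2 if j is in J and u_i < j < u_(i+1), with the
   conventions u_0 = 0 and u_(k+1) = n + 1. *)
Lemma staircase_in j i : j \in J -> (i <= size u)%N ->
    (forall a, i = a.+1 -> (nth j u a < j)%N) ->
    ((i < size u)%N -> (j < nth j u i)%N) ->
  staircase r J j = (i.+1 * r)%N%:Z - 2.
Proof.
move=> jJ iu lo hi; rewrite /staircase jJ (@below _ i) // => a.
  case: i iu lo hi => // i iu lo _; rewrite ltnS leq_eqVlt => /predU1P[->|ai].
    exact: lo.
  by rewrite (ltn_trans _ (lo i _)) // nth_u_lt // ai.
move=> /andP[ia au]; have iu' := leq_ltn_trans ia au.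
move: ia; rewrite leq_eqVlt => /predU1P[<-|ia]; first by rewrite ltnW ?hi.
by rewrite ltnW // (ltn_trans (hi iu')) // nth_u_lt // ia.
Qed.

End StaircaseSpec.

(* Main.v *)
Require Import Defs.
From HB Require Import structures.
From mathcomp Require Import all_boot all_order fingroup perm all_algebra.
From mathcomp Require Import cyclic separable cyclotomic.
From mathcomp Require Import mpoly ring zify.
From mathcomp Require Import reals complex.

(**
Write y = x^r and f_J = \prod_(j in J) x_j \prod_(i > j) (y_j - y_i), and let I
be the coinvariant ideal of F[x_1..x_n], presented as the annihilator of the
functional "coefficient of the Vandermonde-type monomial after alternation".

Contraction with logarithmic derivations maps SI into forms with coefficients
in I, and maps theta_K to f_K theta_K plus terms of larger weight, the weight
of a set of indices being its sum.  Hence, if g theta_J is the lowest term of an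
element of SI, then g lies in (I : f_J).  Conversely the invariant forms
\sum_v x_v^(r-1) h(y_v) theta_v provide, for each j in J, the relation
x_j^(r-1) \prod_(u < j, u notin J) (y_j - y_u) modulo SI and higher terms.  It
remains to see that these relations and the power sums p_(rd) make the
monomials below st(J, r) span, and that the quotient by (I : f_J) is at least
as large as the number of these monomials.

Spanning is shown one variable x at a time, by the split of F[x]/A into
F[x]/(A + (x)) and F[x]/(A : x): for a good choice of x both parts are of the
same shape and the staircase of A is the union of theirs.

For the dimension, f_J is reached from 1 by adding one factor x_j or y_j - y_u
at a time; each step decreases the dimension of F[x]/(I : f) by that of
F[x]/((I : f) + (factor)), which is bounded above by splitting again, now
along linear factors: identifying y_j with y_u turns the power sums into power
sums with positive integral weights, and characteristic 0 keeps these
quotients finite-dimensional.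
*)

Set Implicit Arguments.
Unset Strict Implicit.
Unset Printing Implicit Defensive.

Import Order.TTheory GRing.Theory Num.Theory.
Local Open Scope ring_scope.

(** * Ideals, spanning boxes of monomials, and dimension counts *)

Section Ideals.
Variables (n : nat) (F : fieldType).
Local Notation R := {mpoly F[n]}.
Implicit Types (A B : R -> Prop) (p q a b : R) (d : 'I_n -> nat).

Definition is_ideal A :=
  [/\ A 0, forall a b, A a -> A b -> A (a + b) & forall a b, A b -> A (a * b)].

Definition add_gen A a : R -> Prop := fun p => exists s, A (p - a * s).

Definition colon A a : R -> Prop := fun p => A (a * p).

Section Closure.
Variables (A : R -> Prop) (idA : is_ideal A).

Lemma ideal0 : A 0. Proof. by case: idA. Qed.

Lemma idealD a b : A a -> A b -> A (a + b). Proof. by case: idA => _ + _; exact. Qed.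

Lemma ideal_mull a b : A b -> A (a * b). Proof. by case: idA => _ _; exact. Qed.

Lemma ideal_mulr a b : A a -> A (a * b). Proof. by rewrite mulrC; exact: ideal_mull. Qed.

Lemma idealN a : A a -> A (- a). Proof. by rewrite -mulN1r; exact: ideal_mull. Qed.

Lemma idealB a b : A a -> A b -> A (a - b).
Proof. by move=> Aa Ab; apply: idealD => //; exact: idealN. Qed.

Lemma idealZ (c : F) a : A a -> A (c *: a).
Proof. by rewrite -mul_mpolyC; exact: ideal_mull. Qed.

Lemma ideal_sum (I : Type) (s : seq I) (P : pred I) (f : I -> R) :
  (forall i, P i -> A (f i)) -> A (\sum_(i <- s | P i) f i).
Proof.
by move=> Af; apply: (big_ind A) => //; [exact: ideal0 | exact: idealD].
Qed.

Lemma ideal_congr a b : A (a - b) -> A b -> A a.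
Proof. by move=> Aab Ab; rewrite -(subrK b a); exact: idealD. Qed.

Lemma add_gen_ideal a : is_ideal (add_gen A a).
Proof.
split; [|move=> p q [s As] [t At]|move=> p q [s As]].
- by exists 0; rewrite mulr0 subr0; exact: ideal0.
- exists (s + t); rewrite (_ : _ - _ = (p - a * s) + (q - a * t)); last by ring.
  exact: idealD.
exists (p * s); rewrite (_ : _ - _ = p * (q - a * s)); last by ring.
exact: ideal_mull.
Qed.

Lemma add_genS a p : A p -> add_gen A a p.
Proof. by move=> Ap; exists 0; rewrite mulr0 subr0. Qed.

Lemma add_gen_mem a : add_gen A a a.
Proof. by exists 1; rewrite mulr1 subrr; exact: ideal0. Qed.

Lemma colon_ideal a : is_ideal (colon A a).
Proof.
rewrite /colon; split=> [|p q Ap Aq|p q Aq].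
- by rewrite mulr0; exact: ideal0.
- by rewrite mulrDr; exact: idealD.
- by rewrite mulrCA; exact: ideal_mull.
Qed.

Lemma colonS a p : A p -> colon A a p.
Proof. exact: ideal_mull. Qed.

End Closure.

Lemma add_gen_mono A B a p :
  (forall p, A p -> B p) -> add_gen A a p -> add_gen B a p.
Proof. by move=> AB [s As]; exists s; exact: AB. Qed.

Definition in_box d q := forall m, m \in msupp q -> forall v, (m v < d v)%N.

Definition spans A d := forall p, exists q, in_box d q /\ A (p - q).

Lemma in_boxD d p q : in_box d p -> in_box d q -> in_box d (p + q).
Proof.
move=> dp dq m /msuppD_le; rewrite mem_cat => /orP[/dp|/dq] //.
Qed.

Lemma in_boxW d d' q : (forall v, d v <= d' v)%N -> in_box d q -> in_box d' q.
Proof. by move=> dd' dq m /dq mq v; exact: leq_trans (mq v) (dd' v). Qed.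

Lemma in_boxMX d d' u q :
  (forall v, d v + (v == u) <= d' v)%N -> in_box d q -> in_box d' ('X_u * q).
Proof.
move=> dd' dq m; rewrite mulrC (perm_mem (msuppMX _ _)) => /mapP[k /dq kq ->] v.
rewrite mnmDE mnm1E; move: (kq v) (dd' v); rewrite eq_sym; lia.
Qed.

Lemma spansW A d d' : (forall v, d v <= d' v)%N -> spans A d -> spans A d'.
Proof.
by move=> dd' sA p; have [q [dq Aq]] := sA p; exists q; split=> //; exact: in_boxW dq.
Qed.

Lemma spansS A B d : (forall p, A p -> B p) -> spans A d -> spans B d.
Proof. by move=> AB sA p; have [q [dq /AB]] := sA p; exists q. Qed.

Lemma spans_one A d : is_ideal A -> A 1 -> spans A d.
Proof.
move=> idA A1 p; exists 0; split; first by move=> m; rewrite msupp0.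
by rewrite subr0 -[p]mulr1; exact: ideal_mull.
Qed.

(** Modulo [A], write p = q0 + x_v s with q0 in the first box, then reduce s modulo (A : x_v) to q1;
    the factor x_v shifts the second box by one in direction v. *)
Lemma spans_split A v d d0 d1 : is_ideal A ->
    spans (add_gen A 'X_v) d0 -> spans (colon A 'X_v) d1 ->
    (forall w, d0 w <= d w)%N -> (forall w, d1 w + (w == v) <= d w)%N ->
  spans A d.
Proof.
move=> idA s0 s1 d0d d1d p.
have [q0 [dq0 [s As]]] := s0 p; have [q1 [dq1 Aq1]] := s1 s.
exists (q0 + 'X_v * q1); split.
  by apply: in_boxD; [exact: in_boxW dq0 | exact: in_boxMX dq1].
rewrite (_ : _ - _ = (p - q0 - 'X_v * s) + 'X_v * (s - q1)); last by ring.
exact: idealD.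
Qed.

(** [spans_split] along the chain (A : x_v^i), i < k. As A + (x_v) lies in every (A : x_v^i) +
    (x_v), the one hypothesis on [d0] serves all stages, shifted by at most k - 1. *)
Lemma spans_split_exp A v k d d0 d1 : is_ideal A -> (0 < k)%N ->
    spans (add_gen A 'X_v) d0 -> spans (colon A ('X_v ^+ k)) d1 ->
    (forall w, d0 w + (w == v) * k.-1 <= d w)%N ->
    (forall w, d1 w + (w == v) * k <= d w)%N ->
  spans A d.
Proof.
move=> idA k0 s0; elim: k A d {idA}(idA) k0 s0 => // k IHk A d idA _ s0 s1 d0d d1d.
case: k => [|k] in IHk s1 d0d d1d.
  apply: (spans_split idA s0 s1) => w; first by move: (d0d w); lia.
  by move: (d1d w); rewrite muln1.
apply: (spans_split (d1 := fun w => d w - (w == v))%N idA s0) => [|w|w].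
- apply: IHk => //; first exact: colon_ideal.
  + by apply: spansS s0 => p; apply: add_gen_mono; exact: colonS.
  + by apply: spansS s1 => p; rewrite /colon mulrA -exprS.
  + by move=> w; move: (d0d w); case: eqP; lia.
  + by move=> w; move: (d1d w); case: eqP; lia.
- by move: (d0d w); lia.
- by move: (d1d w); case: eqP; lia.
Qed.

(** [fspans] and [free_mod] bound the dimension of the quotient by [A] from above and from below
    without forming the quotient. *)
Definition fspans A N :=
  exists v : 'I_N -> R, forall p, exists c : 'I_N -> F, A (p - \sum_i c i *: v i).

Definition free_mod A N :=
  exists v : 'I_N -> R,
    forall c : 'I_N -> F, A (\sum_i c i *: v i) -> forall i, c i = 0.

Lemma fspans_split A a N0 N1 : is_ideal A ->
  fspans (add_gen A a) N0 -> fspans (colon A a) N1 -> fspans A (N0 + N1).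
Proof.
move=> idA [v0 s0] [v1 s1].
exists (fun i => match split i with inl j => v0 j | inr k => a * v1 k end) => p.
have [c0 [s As]] := s0 p; have [c1 Ac1] := s1 s.
exists (fun i => match split i with inl j => c0 j | inr k => c1 k end).
rewrite big_split_ord /= (eq_bigr (fun i => c0 i *: v0 i)); last first.
  by move=> i _; rewrite (unsplitK (inl _ i)).
rewrite [X in _ - (_ + X)](eq_bigr (fun i => a * (c1 i *: v1 i))); last first.
  by move=> i _; rewrite (unsplitK (inr _ i)) scalerAr.
rewrite -mulr_sumr.
rewrite (_ : _ - _ = (p - \sum_i c0 i *: v0 i - a * s) +
                     a * (s - \sum_i c1 i *: v1 i)); last by ring.
exact: idealD.
Qed.

Lemma fspans_one A N : is_ideal A -> A 1 -> fspans A N.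
Proof.
move=> idA A1; exists (fun=> 0) => p; exists (fun=> 0).
by rewrite big1 => [|i _]; rewrite ?subr0 ?scaler0 // -[p]mulr1; exact: ideal_mull.
Qed.

Lemma free_modS A B N : (forall p, B p -> A p) -> free_mod A N -> free_mod B N.
Proof. by move=> BA [v fv]; exists v => c /BA; exact: fv. Qed.

Lemma free_mod_leq A N N' : (N' <= N)%N -> free_mod A N -> free_mod A N'.
Proof.
move=> leN [v fv]; exists (v \o widen_ord leN) => c Ac i.
pose c' (j : 'I_N) : F := if insub (j : nat) is Some k then c k else 0.
have c'w k : c' (widen_ord leN k) = c k.
  by rewrite /c'; case: insubP => [l _ /val_inj -> //|]; rewrite /= ltn_ord.
rewrite -c'w; apply: fv.
rewrite (bigID (fun j : 'I_N => (j < N')%N)) /= [X in _ + X]big1 ?addr0; last first.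
  by move=> j ltj; rewrite /c' insubN // scale0r.
rewrite (reindex_onto (widen_ord leN) (fun j => insubd i (j : nat))) /=.
  rewrite (eq_bigl xpredT); last first.
    move=> k; rewrite ltn_ord /=; apply/eqP/val_inj.
    by rewrite val_insubd /= ltn_ord.
  by under eq_bigr => k _ do rewrite c'w.
by move=> j ltj; apply/val_inj; rewrite /= val_insubd ltj.
Qed.

(* Rank-nullity for multiplication by a, read as dim (A : a) = dim A - dim (A + (a)). *)
Lemma free_mod_colon A a N M : is_ideal A ->
  free_mod A N -> fspans (add_gen A a) M -> free_mod (colon A a) (N - M).
Proof.
move=> idA [v fv] [u su].
have /fin_all_exists[cs Acs] : forall i : 'I_N, exists cs : ('I_M -> F) * R,
    A (v i - \sum_j cs.1 j *: u j - a * cs.2).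
  by move=> i; have [c [s As]] := su (v i); exists (c, s).
(* Modulo [A], v_i = \sum_j C_ij u_j + a s_i. The left kernel of C, of dimension at least N - M,
   yields combinations of the v_i that are multiples of a; the same combinations of the s_i form the
   free family. *)
pose C : 'M[F]_(N, M) := \matrix_(i, j) (cs i).1 j.
pose K := row_base (kermx C).
apply: (@free_mod_leq _ (\rank (kermx C))).
  by rewrite mxrank_ker leq_sub2l // rank_leq_col.
exists (fun i => \sum_k K i k *: (cs k).2) => c Ac.
pose l : 'rV[F]_(\rank (kermx C)) := \row_i c i.
have lKC : l *m K *m C = 0.
  have /sub_kermxP KC : (K <= kermx C)%MS by rewrite eq_row_base.
  by rewrite -mulmxA KC mulmx0.
have lK0 : l *m K = 0.
  apply/rowP => k; rewrite [RHS]mxE; move: k; apply: fv.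
  rewrite (_ : \sum_i _ = \sum_i (l *m K) 0 i *:
      (v i - \sum_j (cs i).1 j *: u j - a * (cs i).2) +
      a * (\sum_i (l *m K) 0 i *: (cs i).2)).
    apply: idealD => //; first by apply: ideal_sum => // i _; exact: idealZ.
    suff -> : \sum_i (l *m K) 0 i *: (cs i).2 = \sum_i c i *: \sum_k K i k *: (cs k).2.
      exact: Ac.
    under [RHS]eq_bigr => i _ do rewrite scaler_sumr.
    rewrite exchange_big; apply: eq_bigr => k _ /=.
    rewrite mxE scaler_suml; apply: eq_bigr => i _.
    by rewrite scalerA mxE.
  rewrite mulr_sumr -big_split /=.
  transitivity (\sum_i (l *m K) 0 i *: v i -
                \sum_j (l *m K *m C) 0 j *: u j).
    by rewrite lKC [X in _ - X]big1 ?subr0 // => j _; rewrite mxE scale0r.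
  have -> : \sum_j (l *m K *m C) 0 j *: u j =
            \sum_i (l *m K) 0 i *: (\sum_j (cs i).1 j *: u j).
    under [RHS]eq_bigr => i _ do rewrite scaler_sumr.
    rewrite exchange_big; apply: eq_bigr => j _ /=.
    rewrite mxE scaler_suml; apply: eq_bigr => i _.
    by rewrite scalerA [C _ _]mxE.
  rewrite -sumrB; apply: eq_bigr => i _.
  by rewrite -scalerAr -scalerBr -scalerDr subrK.
have l0 : l = 0.
  by apply/eqP; rewrite -(mulmx_free_eq0 l (row_base_free _)) lK0.
by move=> i; have /rowP/(_ i) := l0; rewrite !mxE.
Qed.

(** The independent v_i expand in the s_j by a square matrix M, invertible because the v_i are
    independent. A relation c among the s_j then becomes the relation c M^-1 among the v_i. *)
Lemma free_of_spanning A (I : finType) (s : I -> R) : is_ideal A ->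
    free_mod A #|I| ->
    (forall p, exists c : I -> F, A (p - \sum_i c i *: s i)) ->
  forall c : I -> F, A (\sum_i c i *: s i) -> forall i, c i = 0.
Proof.
move=> idA [v fv] ss c Ac.
have /fin_all_exists[c' Ac'] : forall i : 'I_#|I|, exists c : I -> F,
    A (v i - \sum_j c j *: s j) by move=> i; exact: ss.
pose s' (j : 'I_#|I|) := s (enum_val j).
have toord (f : I -> F) : \sum_j f j *: s j = \sum_j f (enum_val j) *: s' j.
  by rewrite -(big_enum_val (A := I) (fun j => f j *: s j)).
pose M : 'M[F]_#|I| := \matrix_(i, j) c' i (enum_val j).
have key (l : 'rV_#|I|) : A (\sum_j (l *m M) 0 j *: s' j) -> l = 0.
  move=> Al; apply/rowP => k; rewrite mxE; move: k; apply: fv.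
  rewrite -(subrK (\sum_j (l *m M) 0 j *: s' j) (\sum_i _)).
  apply: idealD => //.
  have -> : \sum_j (l *m M) 0 j *: s' j =
            \sum_i l 0 i *: \sum_j c' i (enum_val j) *: s' j.
    under [RHS]eq_bigr => i _ do rewrite scaler_sumr.
    rewrite exchange_big; apply: eq_bigr => j _ /=.
    rewrite mxE scaler_suml; apply: eq_bigr => i _.
    by rewrite scalerA mxE.
  rewrite -sumrB; apply: ideal_sum => // i _.
  by rewrite -scalerBr -toord; exact: idealZ.
have uM : M \in unitmx.
  rewrite -row_free_unit; apply/row_freeP.
  have := kermx_eq0 M; set fM := row_free M; case: (boolP fM) => [/row_freeP //|nfM].
  move/negP: nfM; case; rewrite /fM -kermx_eq0; apply/eqP/row_matrixP => i.
  rewrite row0; apply: key; rewrite (_ : row i _ *m M = 0).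
    by rewrite big1 => [|j _]; [exact: ideal0 | rewrite mxE scale0r].
  by rewrite -row_mul mulmx_ker row0.
pose l : 'rV_#|I| := \row_j c (enum_val j).
have : l *m invmx M = 0.
  apply: key; rewrite mulmxKV //.
  by under eq_bigr => j _ do rewrite mxE; rewrite -toord.
move/(congr1 (mulmx^~ M)); rewrite mulmxKV // mul0mx => l0 i.
by have /rowP/(_ (enum_rank i)) := l0; rewrite !mxE enum_rankK.
Qed.

End Ideals.

(** * Boxes of monomials as bases of quotients *)

Section Boxes.
Variables (n : nat) (F : fieldType).
Local Notation R := {mpoly F[n]}.
Implicit Types (A : R -> Prop) (p q : R) (d : 'I_n -> nat).

Definition box d : finType := {dffun forall v : 'I_n, 'I_(d v)}.

Definition box_mnm d (g : box d) : 'X_{1..n} := [multinom (g v : nat) | v < n].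

Lemma card_box d : #|box d| = (\prod_v d v)%N.
Proof.
rewrite card_dep_ffun foldrE big_map big_enum /=.
by apply: eq_bigr => v _; rewrite card_ord.
Qed.

Lemma box_mnm_inj d : injective (@box_mnm d).
Proof.
move=> g h /mnmP gh; apply/ffunP => v; apply/val_inj.
by have := gh v; rewrite !mnmE.
Qed.

Lemma in_boxE d q : in_box d q ->
  q = \sum_(g : box d) q@_(box_mnm g) *: 'X_[box_mnm g].
Proof.
move=> dq; apply/mpolyP => m; rewrite linear_sum /=.
under eq_bigr => g _ do rewrite mcoeffZ mcoeffX.
have [/forallP dm | /forallPn[v ndm]] := boolP [forall v, (m v < d v)%N].
  pose g0 : box d := [ffun v => Ordinal (dm v)].
  have eg0 : box_mnm g0 = m by apply/mnmP => v; rewrite mnmE ffunE.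
  rewrite (bigD1 g0) //= eg0 eqxx mulr1 big1 ?addr0 // => g ng.
  by rewrite -eg0 (inj_eq (@box_mnm_inj d)) (negPf ng) mulr0.
rewrite big1 => [|g _].
  by apply: memN_msupp_eq0; apply: contra ndm => /dq/(_ v).
case: eqP => [gm|_]; last by rewrite mulr0.
by case/negP: ndm; rewrite -gm mnmE.
Qed.

Lemma in_box_sum d (c : box d -> F) : in_box d (\sum_g c g *: 'X_[box_mnm g]).
Proof.
move=> m /msupp_sum_le/flattenP[s /mapP[g _ ->]] /msuppZ_le.
by rewrite msuppX inE => /eqP-> v; rewrite mnmE.
Qed.

Lemma mcoeff_box_sum d (c : box d -> F) g :
  (\sum_g c g *: 'X_[box_mnm g] : R)@_(box_mnm g) = c g.
Proof.
rewrite linear_sum (bigD1 g) //= mcoeffZ mcoeffX eqxx mulr1 big1 ?addr0 // => h nh.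
by rewrite mcoeffZ mcoeffX (inj_eq (@box_mnm_inj d)) (negPf nh) mulr0.
Qed.

Lemma fspans_box A d : spans A d -> fspans A (\prod_v d v).
Proof.
rewrite -card_box => sA; exists (fun i => 'X_[box_mnm (enum_val i)]) => p.
have [q [dq Aq]] := sA p; exists (fun i => q@_(box_mnm (enum_val i))).
rewrite -(big_enum_val (A := box d) (fun g => q@_(box_mnm g) *: 'X_[box_mnm g])).
by rewrite -in_boxE.
Qed.

Lemma free_mod_box A d :
  (forall p, in_box d p -> A p -> p = 0) -> free_mod A (\prod_v d v).
Proof.
rewrite -card_box => A0; exists (fun i => 'X_[box_mnm (enum_val i)]) => c Ac i.
pose c' g := c (enum_rank g).
have E : \sum_i c i *: 'X_[box_mnm (enum_val i)] =
         \sum_g c' g *: 'X_[box_mnm g] :> R.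
  rewrite (big_enum_val (A := box d) (fun g => c' g *: 'X_[box_mnm g])).
  by apply: eq_bigr => j _; rewrite /c' enum_valK.
have := mcoeff_box_sum c' (enum_val i); rewrite (A0 _ (@in_box_sum _ c')).
  by rewrite mcoeff0 /c' enum_valK.
by rewrite -E.
Qed.

Lemma in_box_free A d : is_ideal A -> free_mod A (\prod_v d v) -> spans A d ->
  forall p, in_box d p -> A p -> p = 0.
Proof.
rewrite -card_box => idA fA sA p dp Ap; rewrite (in_boxE dp) big1 // => g _.
rewrite (free_of_spanning idA fA (s := fun g => 'X_[box_mnm g]) _
           (c := fun g => p@_(box_mnm g))) ?scale0r -?in_boxE // => q.
by have [q' [/in_boxE-> Aq]] := sA q; exists (fun g => q'@_(box_mnm g)).
Qed.

Lemma spans_exp A d : is_ideal A -> (forall v, A ('X_v ^+ d v)) -> spans A d.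
Proof.
move=> idA Ad p; pose inb (m : 'X_{1..n}) := [forall v, (m v < d v)%N].
exists (\sum_(m <- msupp p | inb m) p@_m *: 'X_[m]); split.
  move=> m /msupp_sum_le/flattenP[s /mapP[k +  ->]] /msuppZ_le.
  by rewrite mem_filter msuppX inE => /andP[/forallP kb _] /eqP->.
rewrite {1}[p]mpolyE (bigID inb) /= addrAC subrr add0r.
apply: ideal_sum => // m /forallPn[v]; rewrite -leqNgt => dm.
apply: idealZ => //.
have -> : m = (U_(v) *+ d v + (m - U_(v) *+ d v))%MM.
  rewrite addmC submK //; apply/mnm_lepP => w; rewrite mulmnE mnm1E.
  by case: eqP => [<-|]; rewrite ?mul1n.
by rewrite mpolyXD -mpolyXn; exact: ideal_mulr.
Qed.

End Boxes.

(** * Ideals containing weighted power sums *)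

Section PowerSums.
Variables (n r : nat) (F : fieldType).
Local Notation R := {mpoly F[n]}.
Implicit Types (A : R -> Prop) (w : 'I_n -> nat) (s : seq 'I_n).
Local Notation Y v := ('X_v ^+ r : R).

Definition psums A w := forall k, A (\sum_v 'X_v ^+ (r * k.+1) *+ w v).

Lemma psumsS A B w : (forall p, A p -> B p) -> psums A w -> psums B w.
Proof. by move=> AB Aw k; exact: AB. Qed.

(* Linear combinations of power sums: \sum_v y_v h(y_v) with h(t) = \prod_(u <- s) (t - y_u). *)
Lemma psums_roots A w s : is_ideal A -> psums A w ->
  A (\sum_v (Y v * \prod_(u <- s) (Y v - Y u)) *+ w v).
Proof.
move=> idA Aw.
(* The power is generalized because a further root u turns y^(k+1) h into y^(k+2) h - y_u y^(k+1)
   h. *)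
suff: forall k, A (\sum_v (Y v ^+ k.+1 * \prod_(u <- s) (Y v - Y u)) *+ w v).
  by move/(_ 0%N); under eq_bigr => v _ do rewrite expr1.
elim: s => [|u s IHs] k.
  under eq_bigr => v _ do rewrite big_nil mulr1 -exprM; exact: Aw.
rewrite (_ : \sum_v _ = \sum_v (Y v ^+ k.+2 * \prod_(u <- s) (Y v - Y u)) *+ w v -
     Y u * \sum_v (Y v ^+ k.+1 * \prod_(u <- s) (Y v - Y u)) *+ w v).
  by apply: idealB => //; apply: ideal_mull.
rewrite mulr_sumr -sumrB; apply: eq_bigr => v _.
rewrite big_cons mulrnAr -mulrnBl [Y v ^+ k.+2]exprS; congr (_ *+ _); ring.
Qed.

End PowerSums.

(** * An upper bound for weighted power sums *)

Definition upd (I : eqType) T (f : I -> T) j x i := if i == j then x else f i.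

Section UpperBound.
Variables (n r : nat) (F : fieldType).
Hypotheses (r_gt0 : (0 < r)%N) (char0 : forall k, k.+1%:R != 0 :> F).
Local Notation R := {mpoly F[n]}.
Local Notation Y v := ('X_v ^+ r : R).
Implicit Types (A : R -> Prop) (U J T : {set 'I_n}) (e w : 'I_n -> nat).
Implicit Types (S : 'I_n -> seq 'I_n).

(* U: indices carrying positive weight; J: indices j whose variable is a root
   of x_j^(e j) \prod_(u <- S j) (y_j - y_u), where y = x^r; T: indices whose
   y has been identified with another one (or with 0). *)
Record rows A U J T e S w : Prop := Rows {
  rows_psums : psums r A w;
  rows_pos : forall u, u \in U -> (0 < w u)%N;
  rows_w0 : forall v, v \notin U -> v \notin J -> w v = 0%N;
  rows_rel : forall j, j \in J -> A ('X_j ^+ e j * \prod_(u <- S j) (Y j - Y u));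
  rows_sub : forall j, j \in J -> {subset S j <= U};
  rows_disj : forall u, u \in U -> u \notin J;
  rows_dead : forall v, v \notin U -> v \notin J -> v \notin T -> A 'X_v;
  rows_ident : forall t, t \in T -> [/\ t \notin U, t \notin J &
    A (Y t) \/ exists2 u, u \in U :|: J & A (Y t - Y u)] }.

(** The product of the expected degrees: r for an identified variable, the degree of its relation
    for a row, and r, 2r, ..., |U| r for the variables of U. *)
Definition rows_dim U J T e S :=
  (r ^ #|T| * (\prod_(j in J) (e j + r * size (S j))) * (#|U|`! * r ^ #|U|))%N.

(** Once x_j = 0, the terms of j leave the power sums, and every y_t identified with y_j becomes
    0. *)
Lemma rows_kill A U J T e S w j : is_ideal A -> rows A U J T e S w -> j \in J ->
  rows (add_gen A 'X_j) U (J :\ j) T e S (upd w j 0%N).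
Proof.
move=> idA [Aw w_gt0 w0 Arel sub disj dead ident] jJ.
have idA' := add_gen_ideal idA 'X_j.
have Xj : add_gen A 'X_j 'X_j by exact: add_gen_mem.
have Yj k : (0 < k)%N -> add_gen A 'X_j ('X_j ^+ k).
  by case: k => // k _; rewrite exprS; apply: ideal_mulr.
split=> //.
- move=> k; rewrite (_ : \sum_v _ = \sum_v 'X_v ^+ (r * k.+1) *+ w v -
      'X_j ^+ (r * k.+1) *+ w j).
    apply: idealB => //; first exact/add_genS/Aw.
    by rewrite -mulr_natr; apply: ideal_mulr => //; apply: Yj; rewrite muln_gt0 r_gt0.
  rewrite (bigD1 j) //= [in RHS](bigD1 j) //= addrAC subrr add0r /upd eqxx mulr0n add0r.
  by apply: eq_bigr => v /negPf->.
- move=> u uU; rewrite /upd; case: eqP => [uj|_]; last exact: w_gt0.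
  by have := disj _ uU; rewrite uj jJ.
- move=> v vU; rewrite !inE /upd negb_and negbK; case: eqP => //= _; exact: w0.
- by move=> l; rewrite !inE => /andP[_ lJ]; apply: add_genS => //; exact: Arel.
- by move=> l; rewrite !inE => /andP[_ lJ]; exact: sub.
- by move=> u uU; rewrite !inE negb_and (disj _ uU) orbT.
- move=> v vU; rewrite !inE negb_and negbK; case: eqP => [-> _ _ //|_ /=] vJ vT.
  by apply: add_genS => //; exact: dead.
move=> t /ident[tU tJ At]; rewrite !inE negb_and tJ orbT; split=> //.
case: At => [At|[u uUJ At]]; first by left; exact: add_genS.
have [uj|nuj] := eqVneq u j.
  have At' : add_gen A 'X_j (Y t - Y u) by exact: add_genS.
  by left; apply: (ideal_congr idA' At'); rewrite uj; exact: Yj.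
right; exists u; last exact: add_genS.
by move: uUJ; rewrite !inE nuj.
Qed.

(** Once y_j = y_u, the terms of j in the power sums become terms of u; this is the source of
    weights other than 1. Whatever was identified with j passes on to u. *)
Lemma rows_merge A U J T e S w j u : is_ideal A -> rows A U J T e S w ->
    j \in J -> u \in U ->
  rows (add_gen A (Y j - Y u)) U (J :\ j) (j |: T) e S
       (upd (upd w u (w u + w j)%N) j 0%N).
Proof.
move=> idA [Aw w_gt0 w0 Arel sub disj dead ident] jJ uU.
have idA' := add_gen_ideal idA (Y j - Y u).
have Xj : add_gen A (Y j - Y u) (Y j - Y u) by exact: add_gen_mem.
have nju : u != j by apply: contraTneq jJ => <-; exact: disj.
split=> //.
- move=> k; rewrite (_ : \sum_v _ = \sum_v 'X_v ^+ (r * k.+1) *+ w v -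
      ('X_j ^+ (r * k.+1) - 'X_u ^+ (r * k.+1)) *+ w j).
    apply: idealB => //; first exact/add_genS/Aw.
    rewrite -mulr_natr !exprM [X in X * _]subrXX -mulrA; exact: (ideal_mulr idA').
  rewrite (bigD1 j) //= (bigD1 u) //= [in RHS](bigD1 j) //= [in RHS](bigD1 u) //=.
  rewrite /upd !eqxx (negPf nju) mulr0n mulrnBl mulrnDr.
  rewrite (eq_bigr (fun v => 'X_v ^+ (r * k.+1) *+ w v)).
    set a := _ *+ w u; set b := _ *+ w j; set c := _ *+ w j.
    by set d := \sum_(i | _) _; clearbody a b c d; ring.
  by move=> v /andP[/negPf-> /negPf->].
- move=> v vU; rewrite /upd; case: eqP => [vj|_].
    by have := disj _ vU; rewrite vj jJ.
  by case: eqP => [_|_]; rewrite ?addn_gt0 ?(w_gt0 u) ?(w_gt0 v).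
- move=> v vU; rewrite !inE /upd negb_and negbK; case: eqP => //= _ vJ.
  by case: eqP => [vu|_]; [rewrite vu uU in vU | exact: w0].
- by move=> l; rewrite !inE => /andP[_ lJ]; apply: add_genS => //; exact: Arel.
- by move=> l; rewrite !inE => /andP[_ lJ]; exact: sub.
- by move=> v vU; rewrite !inE negb_and (disj _ vU) orbT.
- move=> v vU; rewrite !inE negb_and negbK negb_or; case: eqP => //= _ vJ vT.
  by apply: add_genS => //; exact: dead.
move=> t; rewrite !inE; case: (eqVneq t j) => [-> _|ntj /= tT].
  split=> //=; first by apply: contraTN jJ => /disj.
  by right; exists u; rewrite ?inE ?uU.
have [tU tJ At] := ident _ tT; split=> //.
case: At => [At|[v vUJ At]]; first by left; exact: add_genS.
right; have [vj|nvj] := eqVneq v j.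
  exists u; first by rewrite !inE uU.
  have -> : Y t - Y u = (Y t - Y v) + (Y v - Y u) by ring.
  by apply: (idealD idA'); rewrite ?vj //; apply: add_genS => //; rewrite -vj.
exists v; last exact: add_genS.
by move: vUJ; rewrite !inE nvj.
Qed.

(** Serves the passage to a colon ideal, where row j loses the factor divided out. *)
Lemma rows_shorten A A' U J T e S w j k s : (forall p, A p -> A' p) ->
    rows A U J T e S w -> j \in J ->
    A' ('X_j ^+ k * \prod_(u <- s) (Y j - Y u)) -> {subset s <= U} ->
  rows A' U J T (upd e j k) (upd S j s) w.
Proof.
move=> AA' [Aw w_gt0 w0 Arel sub disj dead ident] jJ A'j sU.
split=> //.
- by move=> k'; exact/AA'/Aw.
- move=> l lJ; rewrite /upd; case: eqP => [->//|_]; exact/AA'/Arel.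
- by move=> l lJ; rewrite /upd; case: eqP => // _; exact: sub.
- by move=> v vU vJ vT; exact/AA'/dead.
move=> t /ident[tU tJ [At|[u uUJ At]]]; split=> //; first by left; exact: AA'.
by right; exists u => //; exact: AA'.
Qed.

(** In \sum_v w_v y_v h(y_v), with h vanishing at the y_v for v in U other than u, only w_u y_u
    h(y_u) survives, and w_u > 0 is invertible in characteristic 0. The new row has degree r |U|. *)
Lemma rows_convert A U T e S w u : is_ideal A ->
    rows A U set0 T e S w -> u \in U ->
  rows A (U :\ u) [set u] T (fun=> r) (fun=> enum (U :\ u)) w.
Proof.
move=> idA [Aw w_gt0 w0 Arel sub disj dead ident] uU.
split=> //.
- by move=> v; rewrite inE => /andP[_ /w_gt0].
- by move=> v; rewrite !inE; case: eqP => //= _ vU _; apply: w0; rewrite ?inE.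
- move=> j /set1P ->; have := psums_roots (enum (U :\ u)) idA Aw.
  rewrite (bigD1 u) //= [X in _ + X]big1 ?addr0 => [Au|v nvu].
    have /negPf w1 := char0 (w u).-1; rewrite prednK ?w_gt0 // in w1.
    have := idealZ idA (w u)%:R^-1 Au.
    by rewrite -[(_ * _) *+ w u]scaler_nat scalerA mulVf ?w1 ?scale1r.
  have [vU|nvU] := boolP (v \in U); last by rewrite w0 ?inE.
  rewrite (big_rem v) ?mem_enum ?inE ?nvu //= subrr mul0r mulr0 mul0rn //.
- by move=> j _ v; rewrite mem_enum.
- by move=> v; rewrite !inE; case: eqP.
- move=> v; rewrite !inE; case: eqP => //= _ vU _ vT; apply: dead => //.
  by rewrite inE.
move=> t /ident[tU _ At]; have ntu : t != u by apply: contraNneq tU => ->.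
split; rewrite ?inE ?ntu //.
case: At => [|[v vU At]]; [by left | right; exists v => //].
by move: vU; rewrite !inE orbF; case: eqP => //= _ ->.
Qed.

(** Split row j along x_j while its exponent is positive, then along its factors y_j - y_u; when no
    row is left, convert an element of U. The counts add up since e + r s equals 1 + ((e - 1) + r
    s), and r s equals r + r (s - 1). *)
Lemma fspans_rows A U J T e S w : is_ideal A -> rows A U J T e S w ->
  fspans A (rows_dim U J T e S).
Proof.
elim: {U}_.+1 {-2}U (ltnSn #|U|) A J T e S w => // m IHm U ltUm A J T e S w.
(* The successor makes the measure drop when j is deleted, even if its row is empty. *)
pose size_of J e S := (\sum_(j in J) (e j + size (S j)).+1)%N.
elim: {J e S}_.+1 {-2}J {-2}e {-2}S (ltnSn (size_of J e S)) A T w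
  => // k IHk J e S ltk A T w idA RA.
have [J0|[j jJ]] := set_0Vmem J.
  subst J; have [U0|[u uU]] := set_0Vmem U.
    subst U; rewrite /rows_dim big_set0 cards0 !muln1.
    have -> : (r ^ #|T| = \prod_v (if v \in T then r else 1))%N.
      by rewrite -big_mkcond prod_nat_const.
    apply: fspans_box; apply: spans_exp => // v.
    case: ifP => vT; last by rewrite expr1; apply: (rows_dead RA); rewrite ?inE ?vT.
    by have [_ _ [//|[u]]] := rows_ident RA vT; rewrite !inE.
  have := IHm _ _ A _ T _ _ _ idA (rows_convert idA RA uU).
  rewrite (cardsD1 u) uU ltnS add1n in ltUm; move/(_ ltUm).
  rewrite /rows_dim big_set0 big_set1 [#|U|](cardsD1 u) uU -cardE add1n factS expnS.
  by congr fspans; ring.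
have dimD1 : rows_dim U J T e S =
    ((e j + r * size (S j)) * rows_dim U (J :\ j) T e S)%N.
  by rewrite /rows_dim (big_setD1 j) //=; lia.
have lt1 : (size_of (J :\ j) e S < k)%N.
  by move: ltk; rewrite {1}/size_of (big_setD1 j) //=; rewrite -/(size_of _ _ _); lia.
have Aj := rows_rel RA jJ; have Sj := rows_sub RA jJ.
have colon_case k' s' B : is_ideal B -> (forall p, A p -> B p) ->
    B ('X_j ^+ k' * \prod_(u <- s') (Y j - Y u)) -> {subset s' <= U} ->
    (k' + size s' < e j + size (S j))%N ->
  fspans B ((k' + r * size s') * rows_dim U (J :\ j) T e S)%N.
  move=> idB AB Bj s'U lts.
  have -> : ((k' + r * size s') * rows_dim U (J :\ j) T e S)%N =
      rows_dim U J T (upd e j k') (upd S j s').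
    rewrite /rows_dim [in RHS](big_setD1 j) //= {1 2}/upd eqxx.
    rewrite [X in _ = (_ * (_ * X) * _)%N](eq_bigr (fun l => e l + r * size (S l))%N); first by ring.
    by move=> l; rewrite !inE /upd => /andP[/negPf-> _].
  apply: (IHk _ _ _ _ B T w idB (rows_shorten AB RA jJ Bj s'U)).
  move: ltk; rewrite /size_of (big_setD1 j) //= [in X in (_ -> X)](big_setD1 j) //=.
  rewrite {1 2}/upd eqxx.
  rewrite [X in _ -> (_ + X < _)%N](eq_bigr (fun l => (e l + size (S l)).+1)); last first.
    by move=> l; rewrite !inE /upd => /andP[/negPf-> _].
  by move: lts; set s := (\sum_(l in _) _)%N; lia.
rewrite dimD1; case Ej: (e j) => [|e'].
  case ES: (S j) => [|u s]; rewrite Ej ES in Aj Sj colon_case.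
    by apply: fspans_one => //; move: Aj; rewrite big_nil expr0 mulr1.
  have uU : u \in U by apply: Sj; rewrite inE eqxx.
  have jT : j \notin T by apply: contraL jJ => /(rows_ident RA)[].
  have := IHk _ _ _ lt1 _ _ _ (add_gen_ideal idA (Y j - Y u))
              (rows_merge idA RA jJ uU).
  have -> : rows_dim U (J :\ j) (j |: T) e S = (r * rows_dim U (J :\ j) T e S)%N.
    by rewrite /rows_dim cardsU1 jT expnS; ring.
  rewrite add0n /= mulnS mulnDl.
  move=> sp; apply: (fspans_split idA sp).
  apply: (colon_case 0%N) => //.
  - exact: colon_ideal.
  - by move=> p; exact: colonS.
  - by move: Aj; rewrite /colon big_cons !expr0 !mul1r.
  - by move=> v vs; apply: Sj; rewrite inE vs orbT.
have sp := IHk _ _ _ lt1 _ _ _ (add_gen_ideal idA 'X_j) (rows_kill idA RA jJ).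
rewrite addSn mulSn; apply: (fspans_split idA sp).
apply: colon_case => //; first exact: colon_ideal.
- by move=> p; exact: colonS.
- by move: Aj; rewrite /colon Ej exprS mulrA.
- by rewrite Ej.
Qed.

End UpperBound.

(** * The coinvariant ideal and the lower bound *)

Lemma mcoeffMX_if n (F : fieldType) (p : {mpoly F[n]}) m k :
  (p * 'X_[m])@_k = if (m <= k)%MM then p@_(k - m) else 0.
Proof.
case: ifP => [mk|/negP nmk]; first by rewrite -{1}(submK mk) addmC mcoeffMX.
apply: memN_msupp_eq0; rewrite (perm_mem (msuppMX _ _)).
by apply/mapP => -[l _ kE]; apply: nmk; rewrite kE lem_addr.
Qed.

Lemma fact_exp_prod m r : (m`! * r ^ m = \prod_(i < m) (i.+1 * r))%N.
Proof.
rewrite big_split /= prod_nat_const card_ord; congr (_ * _)%N.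
by rewrite fact_prod big_add1 /= big_mkord.
Qed.

Section CoinvariantIdeal.
Variables (n r : nat) (F : fieldType).
Hypotheses (r_gt0 : (0 < r)%N) (char0 : forall k, k.+1%:R != 0 :> F).
Local Notation R := {mpoly F[n]}.
Local Notation Y v := ('X_v ^+ r : R).
Implicit Types (w : 'S_n) (p q : R) (m : 'X_{1..n}).

Definition delta_mnm w : 'X_{1..n} := [multinom ((w i).+1 * r).-1 | i < n].

(* The coefficient of x^delta, delta = (r-1, 2r-1, ..., nr-1), in the alternation of q. *)
Definition alt_coeff q : F := \sum_(w : 'S_n) (-1) ^+ w * q@_(delta_mnm w).

(* The annihilator of alt_coeff: the ideal generated by the invariants of
   positive degree, although only one inclusion is needed. *)
Definition coinv_ideal p := forall q, alt_coeff (p * q) = 0.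

Lemma alt_coeff_linear : linear_for *%R alt_coeff.
Proof.
move=> c p q; rewrite /alt_coeff mulr_sumr -big_split; apply: eq_bigr => w _ /=.
by rewrite mcoeffD mcoeffZ mulrDr mulrCA.
Qed.
HB.instance Definition _ :=
  GRing.isLinear.Build F R F *%R alt_coeff alt_coeff_linear.

Lemma coinv_ideal_ideal : is_ideal coinv_ideal.
Proof.
split=> [q|p q Ip Iq t|p q Iq t].
- by rewrite mul0r raddf0.
- by rewrite mulrDl raddfD /= Ip Iq addr0.
- by rewrite mulrAC [p * t * q]mulrC Iq.
Qed.

(** The product is fixed by the transposition of i and j, which negates the alternation; the value
    equals its opposite and 2 is invertible. *)
Lemma alt_coeffMX_repeat s m i j : s \is symmetric -> i != j -> m i = m j ->
  alt_coeff (s * 'X_[m]) = 0.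
Proof.
move=> /issymP s_sym nij mij; pose t := tperm i j.
have mt : [multinom m (t k) | k < n] = m.
  by apply/mnmP => k; rewrite mnmE /t; case: tpermP => [->|->|].
have key : alt_coeff (s * 'X_[m]) = - alt_coeff (s * 'X_[m]).
  rewrite {1}/alt_coeff (reindex_inj (mulgI t)) /= -sumrN; apply: eq_bigr => w _.
  rewrite odd_permM odd_tperm nij signr_addb mulN1r mulNr; congr (- (_ * _)).
  have dt : delta_mnm (t * w)%g = [multinom delta_mnm w (t k) | k < n].
    by apply/mnmP => k; rewrite !mnmE permM.
  rewrite !mcoeffMX_if dt.
  have mtk k : m (t k) = m k by rewrite -{2}mt mnmE.
  have -> : (m <= [multinom delta_mnm w (t k) | k < n])%MM = (m <= delta_mnm w)%MM.
    apply/mnm_lepP/mnm_lepP => le k; have := le (t k); rewrite mtk !mnmE //.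
    by rewrite /t tpermK.
  case: ifP => // _; rewrite -[in RHS](s_sym t) mcoeff_sym; congr (s@__).
  by apply/mnmP => k; rewrite -{1}mt !mnmE.
apply/eqP; have := char0 1; apply: contraTT => nz.
rewrite negbK; apply/eqP; apply: (mulIf nz); rewrite mul0r.
by rewrite mulr_natl mulr2n {1}key addNr.
Qed.

(** A nonzero term at w forces m_i = c_i r + r - 1 with c_i <= w(i). The c_i are distinct and below
    n, so they have the same sum as the w(i), whence c = w; but then the coefficient of s involved
    is its constant term. *)
Lemma alt_coeffMX_dvd s m : (forall k, k \in msupp s -> forall i, (r %| k i)%N) ->
    s@_0%MM = 0 -> injective m ->
  alt_coeff (s * 'X_[m]) = 0.
Proof.
move=> s_dvd s0 m_inj; rewrite /alt_coeff big1 // => w _; rewrite mcoeffMX_if.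
case: ifP => [/mnm_lepP mw|_]; last by rewrite mulr0.
have [->|nz] := eqVneq s@_(delta_mnm w - m) 0; first by rewrite mulr0.
have mE i : exists2 c, (c <= w i)%N & m i = (c * r + r.-1)%N.
  have : (delta_mnm w - m)%MM \in msupp s by rewrite mcoeff_msupp.
  move=> /s_dvd/(_ i)/dvdnP[k]; have := mw i; rewrite mnmBE mnmE => le_mw kE.
  have lt_kw : (k <= w i)%N.
    by rewrite -ltnS -(ltn_pmul2r r_gt0); lia.
  exists (w i - k)%N; first exact: leq_subr.
  have := leq_mul lt_kw (leqnn r); move: kE le_mw; rewrite mulnBl !mulSn; lia.
have /fin_all_exists2[c cw mc] := mE.
pose f i : 'I_n := Ordinal (leq_ltn_trans (cw i) (ltn_ord (w i))).
have f_inj : injective f.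
  by move=> i j /(congr1 val) /= cij; apply: m_inj; rewrite !mc cij.
have fw : forall i, c i = w i.
  have : (\sum_i (w i - c i) = 0)%N.
    rewrite sumnB; last by move=> i _; exact: cw.
    have -> : (\sum_i c i = \sum_(i < n) i)%N by rewrite [RHS](reindex_inj f_inj).
    by rewrite [X in (_ - X)%N](reindex_inj (@perm_inj _ w)) subnn.
  move/eqP; rewrite sum_nat_eq0 => /forallP wc i.
  by apply/eqP; rewrite eqn_leq cw -subn_eq0 /= (implyP (wc i)).
case/eqP: nz; rewrite (_ : _ - _ = 0)%MM //; apply/mnmP => i.
by rewrite mnmBE mnmE mnm0E mc fw; lia.
Qed.

(** It suffices to test against monomials: repeated exponents are settled by symmetry, distinct ones
    by divisibility by r. *)
Lemma coinv_ideal_sym s : s \is symmetric ->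
    (forall m, m \in msupp s -> forall i, (r %| m i)%N) -> s@_0%MM = 0 ->
  coinv_ideal s.
Proof.
move=> s_sym s_dvd s0 q; rewrite [q]mpolyE mulr_sumr raddf_sum big1 // => m _ /=.
rewrite -scalerAr linearZ /=; apply/eqP; rewrite mulf_eq0; apply/orP; right.
have [/injectiveP m_inj|/injectivePn[i [j nij mij]]] := boolP (injectiveb m).
  by rewrite alt_coeffMX_dvd.
by rewrite (alt_coeffMX_repeat s_sym nij mij).
Qed.

(** Test p against x^(delta - a), a being the leading exponent. The identity contributes the leading
    coefficient. Any other w would use an exponent m of p with m + delta = w(delta) + a; at the
    first index k where m and a differ, w(k) >= k gives m_k >= a_k, against m < a. So m = a and w =
    1. *)
Lemma coinv_ideal_box p :
  in_box (fun v => v.+1 * r)%N p -> coinv_ideal p -> p = 0.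
Proof.
move=> dp Ip; apply/eqP; apply: contraT => p0.
pose a := mlead p; have ap : a \in msupp p by exact: mlead_supp.
pose d := delta_mnm 1.
have dE i : d i = (i.+1 * r).-1 by rewrite mnmE perm1.
have ad : (a <= d)%MM.
  by apply/mnm_lepP => i; rewrite dE; have := dp _ ap i; lia.
have := Ip 'X_[d - a]; rewrite /alt_coeff (bigD1 1%g) //= odd_perm1 mul1r.
rewrite mcoeffMX_if lem_subr submBA // addmC addmK big1 ?addr0.
  by move/eqP; rewrite mleadc_eq0 (negPf p0).
move=> w nw1; rewrite mcoeffMX_if; case: ifP => [/mnm_lepP le|_]; last by rewrite mulr0.
set m := (_ - _)%MM.
have [mp|/memN_msupp_eq0->] := boolP (m \in msupp p); last by rewrite mulr0.
have mE i : (m i + (i.+1 * r).-1 = ((w i).+1 * r).-1 + a i)%N.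
  have := le i; have /mnm_lepP/(_ i) := ad.
  by rewrite !mnmBE !mnmE perm1; lia.
have sum_eq : mdeg m = mdeg a.
  have : (\sum_i (m i + (i.+1 * r).-1) = \sum_i (((w i).+1 * r).-1 + a i))%N.
    by apply: eq_bigr => i _; exact: mE.
  rewrite !big_split /= !mdegE.
  by rewrite [X in (_ + X)%N](reindex_inj (@perm_inj _ w)) /= addnC => /addnI.
have m_eq_a : m = a.
  apply/eqP; apply: contraT => nma.
  have : (m < a)%O by rewrite lt_neqAle nma msupp_le_mlead.
  case/(ltmcP sum_eq) => k eq_below lt_k.
  have w_below (i : 'I_n) : (i < k)%N -> w i = i.
    move=> ik; apply/val_inj => /=; have := mE i; rewrite (eq_below _ ik).
    have : (0 < (w i).+1 * r)%N by rewrite muln_gt0.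
    have : (0 < i.+1 * r)%N by rewrite muln_gt0.
    move=> ? ? ?; have : (i.+1 * r = (w i).+1 * r)%N by lia.
    by move/eqP; rewrite eqn_pmul2r // eqSS => /eqP.
  have : (k <= w k)%N.
    rewrite leqNgt; apply/negP => wk; have := w_below _ wk => /perm_inj ekw.
    by rewrite ekw ltnn in wk.
  by rewrite -ltnS -(leq_pmul2r r_gt0) => ?; have := mE k; lia.
case/negP: nw1; apply/eqP/permP => i; rewrite perm1; apply/val_inj => /=.
have := mE i; rewrite m_eq_a.
have : (0 < (w i).+1 * r)%N by rewrite muln_gt0.
have : (0 < i.+1 * r)%N by rewrite muln_gt0.
move=> ? ? ?; have : (i.+1 * r = (w i).+1 * r)%N by lia.
by move/eqP; rewrite eqn_pmul2r // eqSS => /eqP.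
Qed.

Lemma coinv_ideal_psums : psums r coinv_ideal (fun=> 1%N).
Proof.
move=> k; apply: coinv_ideal_sym.
- apply/issymP => w; rewrite raddf_sum /= [RHS](reindex_inj (@perm_inj _ w)) /=.
  apply: eq_bigr => v _; rewrite !mulr1n rmorphXn /= msymX; congr ('X_[_] ^+ _).
  apply/mnmP => i; rewrite mnmE !mnm1E.
  by rewrite -(inj_eq (@perm_inj _ w)) permKV.
- move=> m; rewrite mcoeff_msupp => nz i; move: nz; rewrite linear_sum /=.
  apply: contraR => ndvd; rewrite big1 // => v _; rewrite mulr1n mcoeffXn.
  case: eqP => // mE; case/negP: ndvd; rewrite -mE mulmnE mulnCA.
  exact: dvdn_mulr.
rewrite linear_sum big1 //= => v _; rewrite mulr1n mcoeffXn.
case: eqP => // /mnmP/(_ v); rewrite mulmnE mnm1E eqxx mnm0E mul1n.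
by move/eqP; rewrite muln_eq0 orbF eqn0Ngt r_gt0.
Qed.

(** * Lower bound for the quotient by (I : f), one factor at a time *)

Section LowerBound.
Implicit Types (J : {set 'I_n}) (k : 'I_n -> nat) (T : 'I_n -> {set 'I_n}).

(** The partial products between 1 and f_J: row j has so far received x_j^(k j) and the factors with
    index in T j. *)
Definition root_prod J k T : R :=
  \prod_(j in J) ('X_j ^+ k j * \prod_(i in T j) (Y j - Y i)).

(** [rows_dim] for the relations that are left: row j retains x_j^(r - k j) and the factors with
    index outside J and T j. *)
Definition root_dim J k T :=
  (\prod_(j in J) (r - k j + r * #|~: J :\: T j|) * (#|~: J|`! * r ^ #|~: J|))%N.

Definition root_data J k T := forall j, j \in J ->
  [/\ (k j <= r)%N, j \notin T j & forall l, l \in J -> (l \in T j) = (j < l)%N].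

Lemma full_row_mem j : coinv_ideal (Y j * \prod_(i in ~: [set j]) (Y j - Y i)).
Proof.
have := psums_roots (enum (~: [set j])) coinv_ideal_ideal coinv_ideal_psums.
rewrite (bigD1 j) //= [X in _ + X]big1 ?addr0 ?mulr1n ?big_enum // => v nvj.
by rewrite big_enum (bigD1 v) ?inE ?nvj //= subrr mul0r mulr0 mul0rn.
Qed.

(** The product is a multiple of y_j \prod_(i != j) (y_j - y_i): for l in J with l < j, the factor
    y_j - y_l is supplied, up to sign, by row l. *)
Lemma root_prod_row J k T j : root_data J k T -> j \in J ->
  coinv_ideal (root_prod J k T *
    ('X_j ^+ (r - k j) * \prod_(u in ~: J :\: T j) (Y j - Y u))).
Proof.
move=> D jJ; have [kj jTj Tj] := D _ jJ.
have [q ->] : exists q, root_prod J k T *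
    ('X_j ^+ (r - k j) * \prod_(u in ~: J :\: T j) (Y j - Y u)) =
    Y j * \prod_(i in ~: [set j]) (Y j - Y i) * q; last first.
  exact: (ideal_mulr coinv_ideal_ideal _ (full_row_mem j)).
pose L := [set l in J | (l < j)%N].
have [q1 q1E] : exists q1, \prod_(l in J :\ j) ('X_l ^+ k l *
    \prod_(i in T l) (Y l - Y i)) = (\prod_(l in L) (Y j - Y l)) * q1.
  exists (\prod_(l in J :\ j) ('X_l ^+ k l *
      \prod_(i in T l :\ j) (Y l - Y i)) * \prod_(l in L) -1).
  rewrite mulrCA -big_split /= (big_setID L) /= [in RHS](big_setID L) /= mulrAC.
  have -> : (J :\ j) :&: L = L.
    apply/setP => l; rewrite !inE -val_eqE /=.
    by case: (l \in J); rewrite ?andbF //; case: ltngtP.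
  rewrite -big_split /=; congr (_ * _); apply: eq_bigr => l.
    rewrite inE => /andP[lJ lj]; have [_ _ Tl] := D _ lJ.
    rewrite (big_setD1 j) ?Tl //=; ring.
  rewrite !inE => /and3P[nlL nlj lJ]; have [_ _ Tl] := D _ lJ.
  rewrite (_ : T l :\ j = T l) //; apply/setP => i; rewrite !inE.
  by case: eqP => //= ->; rewrite Tl //; move: nlL; rewrite lJ /= => /negPf->.
have prodU (A B : {set 'I_n}) (G : 'I_n -> R) : A :&: B = set0 ->
    \prod_(i in A :|: B) G i = (\prod_(i in A) G i) * \prod_(i in B) G i.
  move=> AB0; rewrite -bigU /=; last by rewrite -setI_eq0 AB0.
  by apply: eq_bigl => i; rewrite !inE.
rewrite /root_prod (big_setD1 j) //= q1E; exists q1.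
have -> : ~: [set j] = T j :|: ((~: J :\: T j) :|: L).
  apply/setP => i; rewrite !inE; case iJ: (i \in J) => /=.
    by rewrite Tj // andbF -val_eqE /=; case: ltngtP.
  rewrite andbT orbF orbN; case: eqP => // ij; by rewrite ij jJ in iJ.
rewrite prodU; last first.
  apply/setP => i; rewrite !inE.
  case: (boolP (i \in J)) => iJ; first by rewrite Tj //=; case: ltngtP.
  by case: (i \in T j).
rewrite prodU; last first.
  apply/setP => i; rewrite !inE.
  by case: (i \in J); rewrite ?andbF.
rewrite -[in Y j](subnK kj) exprD; ring.
Qed.

Lemma root_prod_rows J k T : root_data J k T ->
  rows r (colon coinv_ideal (root_prod J k T)) (~: J) J set0
       (fun j => r - k j)%N (fun j => enum (~: J :\: T j)) (fun=> 1%N).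
Proof.
move=> D; have idI := coinv_ideal_ideal; split=> //.
- by apply: psumsS coinv_ideal_psums => p; exact: colonS.
- by move=> v; rewrite inE negbK => -> .
- by move=> j jJ; rewrite big_enum; exact: root_prod_row.
- by move=> j jJ v; rewrite mem_enum inE => /andP[].
- by move=> u; rewrite inE.
- by move=> v; rewrite inE negbK => ->.
by move=> t; rewrite inE.
Qed.

Definition root_free J k T :=
  free_mod (colon coinv_ideal (root_prod J k T)) (root_dim J k T).

Lemma eq_root_free J k k' T T' :
  (forall j, j \in J -> k j = k' j) -> (forall j, j \in J -> T j = T' j) ->
  root_free J k T -> root_free J k' T'.
Proof.
move=> kk' TT'; rewrite /root_free /root_dim /root_prod.
rewrite (eq_bigr (fun j => 'X_j ^+ k' j * \prod_(i in T' j) (Y j - Y i))); last first.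
  by move=> j jJ; rewrite kk' ?TT'.
rewrite (eq_bigr (fun j => r - k' j + r * #|~: J :\: T' j|)%N) //.
by move=> j jJ; rewrite kk' ?TT'.
Qed.

(** By [free_mod_colon], the factor x_j costs at most the dimension modulo x_j, which [rows_kill]
    and [fspans_rows] bound; the difference is exactly the new [root_dim]. *)
Lemma root_free_exp J k T j : root_data J k T -> j \in J -> (k j < r)%N ->
  root_free J k T -> root_free J (upd k j (k j).+1) T.
Proof.
move=> D jJ kj fJ; have RA := root_prod_rows D.
have idA := colon_ideal coinv_ideal_ideal (root_prod J k T).
have sp := fspans_rows r_gt0 char0 (add_gen_ideal idA _) (rows_kill r_gt0 idA RA jJ).
have := free_mod_colon idA fJ sp.
rewrite /root_free; have <- : root_dim J (upd k j (k j).+1) T =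
    (root_dim J k T - rows_dim r (~: J) (J :\ j) set0 (fun j => r - k j)
       (fun j => enum (~: J :\: T j)))%N.
  rewrite /root_dim /rows_dim cards0 expn0 mul1n (big_setD1 j) //= [in RHS](big_setD1 j) //=.
  rewrite {1}/upd eqxx.
  rewrite [X in (_ * X * _)%N](eq_bigr (fun l => r - k l + r * #|~: J :\: T l|)%N); last first.
    by move=> l; rewrite !inE /upd => /andP[/negPf-> _].
  rewrite [X in (_ - X * _)%N](eq_bigr (fun l => r - k l + r * #|~: J :\: T l|)%N); last first.
    by move=> l _; rewrite -cardE.
  by rewrite -(subnSK kj) addSn -!mulnA mulSn addKn.
apply: free_modS => p; rewrite /colon mulrA.
rewrite (_ : root_prod _ _ _ = root_prod J k T * 'X_j) //.
rewrite /root_prod (big_setD1 j) //= [in RHS](big_setD1 j) //= {1}/upd eqxx exprSr.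
rewrite [X in _ * X = _](eq_bigr (fun l => 'X_l ^+ k l * \prod_(i in T l) (Y l - Y i))); first by ring.
by move=> l; rewrite !inE /upd => /andP[/negPf-> _].
Qed.

(** As for x_j, but with [rows_merge]: the identified variable x_j makes the cost r times larger. *)
Lemma root_free_root J k T j i : root_data J k T -> j \in J ->
    i \notin J -> i \notin T j ->
  root_free J k T -> root_free J k (upd T j (i |: T j)).
Proof.
move=> D jJ iJ iT fJ; have RA := root_prod_rows D.
have idA := colon_ideal coinv_ideal_ideal (root_prod J k T).
have iCJ : i \in ~: J by rewrite inE.
have sp := fspans_rows r_gt0 char0 (add_gen_ideal idA _)
             (rows_merge idA RA jJ iCJ).
have := free_mod_colon idA fJ sp.
rewrite /root_free; have <- : root_dim J k (upd T j (i |: T j)) =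
    (root_dim J k T - rows_dim r (~: J) (J :\ j) (j |: set0) (fun j => r - k j)
       (fun j => enum (~: J :\: T j)))%N.
  rewrite /root_dim /rows_dim setU0 cards1 expn1 (big_setD1 j) //= [in RHS](big_setD1 j) //=.
  rewrite {1}/upd eqxx.
  rewrite [X in (_ * X * _)%N](eq_bigr (fun l => r - k l + r * #|~: J :\: T l|)%N); last first.
    by move=> l; rewrite !inE /upd => /andP[/negPf-> _].
  rewrite [X in (_ - _ * X * _)%N](eq_bigr (fun l => r - k l + r * #|~: J :\: T l|)%N); last first.
    by move=> l _; rewrite -cardE.
  rewrite [in RHS](cardsD1 i) !inE iJ iT /=.
  have -> : ~: J :\: T j :\ i = ~: J :\: (i |: T j).
    by apply/setP => l; rewrite !inE negb_or andbA.
  by rewrite mulnS addnCA !mulnDl -mulnDl addKn.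
apply: free_modS => p; rewrite /colon mulrA.
rewrite (_ : root_prod _ _ _ = root_prod J k T * (Y j - Y i)) //.
rewrite /root_prod (big_setD1 j) //= [in RHS](big_setD1 j) //= {1}/upd eqxx.
rewrite (big_setU1 _ iT) /=.
rewrite [X in _ * X = _](eq_bigr (fun l => 'X_l ^+ k l * \prod_(i in T l) (Y l - Y i))); first by ring.
by move=> l; rewrite !inE /upd => /andP[/negPf-> _].
Qed.

(** Induction on |J|, removing the largest j. Then T j avoids J, so the factors of row j can be put
    back one by one with the two preceding lemmas. For empty J the count n! r^n is the size of the
    box in [coinv_ideal_box]. *)
Lemma root_freeP J k T : root_data J k T -> root_free J k T.
Proof.
elim: {J}_.+1 {-2}J (ltnSn #|J|) k T => // N IHN J ltJ k T D.
have [J0|[j0 j0J]] := set_0Vmem J.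
  subst J; rewrite /root_free /root_dim big_set0 mul1n setC0 cardsT card_ord.
  apply: (free_modS (A := coinv_ideal)) => [p|].
    by rewrite /colon /root_prod big_set0 mul1r.
  rewrite fact_exp_prod.
  exact: (free_mod_box coinv_ideal_box).
have [j jJ j_max] := arg_maxnP (fun j : 'I_n => j : nat) j0J.
have {}jJ : j \in J := jJ.
have {}j_max l : l \in J -> (l < j)%N || (l == j).
  by move=> lJ; rewrite orbC -leq_eqVlt; exact: j_max.
have [kj jTj Tj] := D _ jJ.
have TJ i : i \in T j -> i \notin J.
  move=> iT; apply/negP => iJ; move: iT; rewrite Tj // => ji.
  by case/orP: (j_max _ iJ) => [|/eqP ij]; [rewrite ltnNge ltnW | rewrite ij ltnn in ji].
have D' x (A : {set 'I_n}) : (x <= r)%N -> {subset A <= T j} ->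
    root_data J (upd k j x) (upd T j A).
  move=> xr AT l lJ; rewrite /upd; case: eqP => [->|_]; last exact: D.
  split=> // [|i iJ]; first by apply: contra jTj; exact: AT.
  rewrite ltnNge (_ : (i <= j)%N); last by case/orP: (j_max _ iJ) => [/ltnW|/eqP->].
  by apply/negP => /AT/TJ; rewrite iJ.
have D0 : root_data (J :\ j) k T.
  move=> l; rewrite inE => /andP[_ /D[kl lT Tl]]; split=> // i.
  by rewrite inE => /andP[_]; exact: Tl.
(* With row j empty both counts agree: its factor r + r |~: J| is the one by which |~: J|! r^|~: J|
   grows when j joins the complement. *)
have start : root_free J (upd k j 0%N) (upd T j set0).
  have ltJ' : (#|J :\ j| < N)%N by rewrite (cardsD1 j) jJ in ltJ.
  have := IHN _ ltJ' _ _ D0; rewrite /root_free.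
  have -> : root_prod J (upd k j 0%N) (upd T j set0) = root_prod (J :\ j) k T.
    rewrite /root_prod (big_setD1 j) //= {1 2}/upd eqxx big_set0 !mul1r.
    by apply: eq_bigr => l; rewrite !inE /upd => /andP[/negPf-> _].
  have CJ : ~: (J :\ j) = j |: ~: J.
    by apply/setP => l; rewrite !inE negb_and negbK.
  have -> : root_dim J (upd k j 0%N) (upd T j set0) = root_dim (J :\ j) k T; last by [].
  rewrite /root_dim (big_setD1 j) //= CJ cardsU1 inE jJ add1n factS expnS.
  rewrite {1 2}/upd eqxx subn0 setD0.
  rewrite [X in (_ * X * _ = _)%N](eq_bigr (fun l => r - k l + r * #|(j |: ~: J) :\: T l|)%N).
    by ring.
  move=> l; rewrite !inE /upd => /andP[lj lJ]; rewrite (negPf lj).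
  congr (_ + _ * _)%N; apply: eq_card => i; rewrite !inE.
  case: eqP => //= ->; rewrite jJ andbT; have [_ _ ->//] := D _ lJ.
  by case/orP: (j_max _ lJ) => [->|/eqP lj']; [|rewrite lj' eqxx in lj].
have exps x : (x <= k j)%N -> root_free J (upd k j x) (upd T j set0).
  elim: x => // x IHx lt_x; have := root_free_exp (D' x set0 _ _) jJ _ (IHx (ltnW lt_x)).
  have -> : upd k j x j = x by rewrite /upd eqxx.
  have xr := leq_trans lt_x kj; move=> /(_ (ltnW xr) _ xr) H.
  apply: eq_root_free (H _) => // [l _|l]; last by rewrite inE.
  by rewrite /upd; case: eqP.
have roots s : uniq s -> {subset s <= T j} ->
    root_free J (upd k j (k j)) (upd T j [set i in s]).
  elim: s => [_ _|i s IHs /= /andP[nis us] sT].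
    exact: exps.
  have sT' : {subset s <= T j} by move=> l ls; apply: sT; rewrite inE ls orbT.
  have iJ : i \notin J by apply/TJ/sT; rewrite inE eqxx.
  have D1 : root_data J (upd k j (k j)) (upd T j [set i in s]).
    by apply: D' => // l; rewrite inE => /sT'.
  have := root_free_root D1 jJ iJ _ (IHs us sT').
  rewrite {1 3}/upd eqxx inE nis => /(_ isT); apply: eq_root_free => // l _.
  by rewrite /upd eqxx; case: (l == j) => //; apply/setP => x; rewrite !inE.
apply: eq_root_free (roots (enum (T j)) (enum_uniq _) _) => [l _|l _|l].
- by rewrite /upd; case: eqP => [->|].
- by rewrite /upd; case: eqP => [->|//]; apply/setP => i; rewrite inE mem_enum.
by rewrite mem_enum.
Qed.

End LowerBound.
End CoinvariantIdeal.

(** * Spanning by staircase monomials *)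

Section StaircaseSpans.
Variables (n r : nat) (F : fieldType).
Hypotheses (r_gt0 : (0 < r)%N) (char0 : forall k, k.+1%:R != 0 :> F).
Local Notation R := {mpoly F[n]}.
Local Notation Y v := ('X_v ^+ r : R).
Implicit Types (A : R -> Prop) (z : seq 'I_n) (c e : 'I_n -> nat).

(* The columns z come in order; a variable v outside z is a root of
   x_v^(e v) \prod_(a among the first c v columns) (y_v - y_a).  The case
   c v = 0, e v = 1 means x_v = 0. *)
Record staircase_data A z c e : Prop := StaircaseData {
  sd_psums : psums r A (fun=> 1%N);
  sd_uniq : uniq z;
  sd_size : forall v, v \notin z -> (c v <= size z)%N;
  sd_rel : forall v, v \notin z ->
    A ('X_v ^+ e v * \prod_(a <- take (c v) z) (Y v - Y a)) }.

Definition staircase_bound z c e v :=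
  (if v \in z then (index v z).+1 * r else e v + c v * r)%N.

Lemma staircase_dataS A A' z c e : (forall p, A p -> A' p) ->
  staircase_data A z c e -> staircase_data A' z c e.
Proof.
move=> AA' [As uz sz Ar]; split=> //; first exact: psumsS As.
by move=> v /Ar/AA'.
Qed.

Lemma sd_upd A A' z c e j cj ej : (forall p, A p -> A' p) ->
    staircase_data A z c e -> (cj <= size z)%N ->
    A' ('X_j ^+ ej * \prod_(a <- take cj z) (Y j - Y a)) ->
  staircase_data A' z (upd c j cj) (upd e j ej).
Proof.
move=> AA' [As uz sz Ar] cjz A'j; split=> //; first exact: psumsS As.
  by move=> v vz; rewrite /upd; case: eqP => // _; exact: sz.
by move=> v vz; rewrite /upd; case: eqP => [->//|_]; exact/AA'/Ar.
Qed.

Definition drop_col (i : nat) u c v :=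
  (if v == u then 0 else if i < c v then (c v).-1 else c v)%N.
Definition drop_exp (i : nat) u c e v :=
  (if v == u then 1 else if i < c v then e v + r else e v)%N.

(* Modulo x_u the factor y_v - y_u becomes x_v^r. *)
Lemma sd_drop A z1 u z2 c e : is_ideal A ->
    staircase_data A (z1 ++ u :: z2) c e ->
  staircase_data (add_gen A 'X_u) (z1 ++ z2)
    (drop_col (size z1) u c) (drop_exp (size z1) u c e).
Proof.
move=> idA [As uz sz Ar]; have idA' := add_gen_ideal idA 'X_u.
split.
- by apply: psumsS As => p; exact: add_genS.
- by move: uz; rewrite !cat_uniq /= negb_or -!andbA => /and5P[-> _ -> _ ->].
- move=> v; rewrite mem_cat => vz; rewrite /drop_col; case: eqP => // /eqP nvu.
  have := sz v; rewrite mem_cat inE (negPf nvu) size_cat /= => /(_ vz).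
  by rewrite size_cat; case: ltnP; lia.
move=> v; rewrite mem_cat => vz; rewrite /drop_col /drop_exp; case: eqP => [->|/eqP nvu].
  by rewrite take0 big_nil mulr1 expr1; exact: add_gen_mem.
have := Ar v; rewrite mem_cat inE (negPf nvu) => /(_ vz).
case: ltnP => [lt|le] Av.
  have Av' := add_genS 'X_u Av.
  apply: (ideal_congr idA' _ Av').
  have -> : take (c v) (z1 ++ u :: z2) = z1 ++ u :: take (c v - size z1).-1 z2.
    by rewrite take_cat ltnNge (ltnW lt) /=; case: (c v - size z1)%N (subn_gt0 (size z1) (c v)); rewrite ?lt.
  have -> : take (c v).-1 (z1 ++ z2) = z1 ++ take (c v - size z1).-1 z2.
    by rewrite take_cat ltnNge -ltnS prednK ?lt /= ?(leq_ltn_trans _ lt) //; congr (_ ++ take _ _); lia.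
  rewrite !big_cat big_cons /= exprD.
  rewrite (_ : _ - _ = 'X_u * ('X_u ^+ r.-1 * 'X_v ^+ e v *
    (\prod_(i <- z1) (Y v - Y i)) * \prod_(i <- take (c v - size z1).-1 z2) (Y v - Y i))).
    by apply: ideal_mulr => //; exact: add_gen_mem.
  rewrite !mulrA -exprS prednK //; ring.
apply: add_genS => //; move: Av; rewrite !take_cat.
case: ltnP => // le'; have -> : c v = size z1 by apply/eqP; rewrite eqn_leq le.
by rewrite subnn !take0.
Qed.

(** The staircase left after division by x_u^r for every column u of index at least i; each such
    column loses r. *)
Definition partial_bound z c e i v :=
  (if v \in z then (index v z + (index v z < i)) * r else e v + c v * r)%N.

(* Splitting off the variables of the columns z_i, z_(i-1), ..., z_1 in this
   order.  With Z_i(t) = \prod_(a < i) (t - z_a) and s_i the sum of Z_i(y_v)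
   over v in B, the combination \sum_v y_v Z_i(y_v) of power sums is
   s_(i+1) + z_i s_i, so that s_(i+1) in A forces s_i in (A : z_i), and
   s_0 = #|B| is invertible. *)
Lemma spans_columns A z c e (B : {set 'I_n}) : is_ideal A ->
    staircase_data A z c e -> (0 < #|B|)%N ->
    (forall v, v \notin B -> A 'X_v) ->
    (forall A' z' c' e', (size z' < size z)%N -> is_ideal A' ->
       staircase_data A' z' c' e' -> spans A' (staircase_bound z' c' e')) ->
  forall i, (i <= size z)%N -> forall A', is_ideal A' -> (forall p, A p -> A' p) ->
    A' (\sum_(v in B) \prod_(a <- take i z) (Y v - Y a)) ->
  spans A' (partial_bound z c e i).
Proof.
move=> idA SD B0 AB IH; elim=> [_|i IHi lt_i] A' idA' AA' A's.
  apply: spans_one => //; move: A's; under eq_bigr => v _ do rewrite take0 big_nil.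
  rewrite sumr_const; case: #|B| B0 (char0 #|B|.-1) => // k _ nz.
  move/(idealZ idA' k.+1%:R^-1); rewrite -scaler_nat scalerA mulVf ?scale1r //.
case Ez: z => [|x0 z0]; first by rewrite Ez in lt_i.
rewrite -{}Ez; pose u := nth x0 z i; pose z1 := take i z; pose z2 := drop i.+1 z.
have zE : z = z1 ++ u :: z2 by rewrite -drop_nth // cat_take_drop.
have z1i : size z1 = i by rewrite size_takel // ltnW.
have SD' : staircase_data A' (z1 ++ u :: z2) c e by rewrite -zE; exact: staircase_dataS SD.
have := sd_uniq SD; rewrite {1}zE cat_uniq /= negb_or -!andbA => /and5P[uz1 uz1' uz12 uz2' uz2].
have idx_u : index u z = i by rewrite index_uniq // (sd_uniq SD).
have uz : u \in z by exact: mem_nth.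
(* Modulo x_u there is one column fewer, which the hypothesis on shorter [z] covers; (A' : x_u^r) is
   the induction step. *)
apply: (spans_split_exp (v := u) (k := r) (d0 := staircase_bound (z1 ++ z2)
    (drop_col i u c) (drop_exp i u c e)) (d1 := partial_bound z c e i)) => //.
- apply: IH; last by rewrite -z1i; exact: sd_drop.
    by rewrite zE !size_cat /= addnS.
  exact: add_gen_ideal.
- apply: IHi => //; first exact: ltnW.
  + exact: colon_ideal.
  + by move=> p /AA'; exact: colonS.
  have A'p : A' (\sum_v (Y v * \prod_(a <- take i z) (Y v - Y a)) *+ 1).
    by apply: psums_roots => //; apply: psumsS (sd_psums SD).
  rewrite /colon; apply: (ideal_congr idA' (b := - \sum_(v in B) \prod_(a <- take i.+1 z) (Y v - Y a))).
    rewrite opprK (_ : _ + _ = \sum_(v in B) Y v * \prod_(a <- take i z) (Y v - Y a)).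
      rewrite (bigID (mem B)) /= in A'p.
      apply: (ideal_congr idA' _ A'p); rewrite opprD addrA -sumrB.
      apply: idealB => //.
        rewrite big1 => [|v _]; [exact: ideal0 | by rewrite mulr1n subrr].
      apply: ideal_sum => // v vB; rewrite mulr1n -(prednK r_gt0) exprS -mulrA.
      by apply: ideal_mulr => //; exact/AA'/AB.
    rewrite mulr_sumr -big_split; apply: eq_bigr => v _ /=.
    by rewrite (take_nth x0) // -/u -cats1 big_cat big_seq1 /=; ring.
  exact: idealN.
- move=> w; rewrite /staircase_bound /partial_bound /drop_col /drop_exp.
  have -> : (w \in z) = [|| w \in z1, w == u | w \in z2] by rewrite zE mem_cat inE.
  have -> : index w z = (if w \in z1 then index w z1
                         else size z1 + if u == w then 0 else (index w z2).+1)%N.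
    by rewrite zE index_cat.
  rewrite mem_cat index_cat z1i [u == w]eq_sym.
  case: (eqVneq w u) => [->|nwu]; first by rewrite (negPf uz1') (negPf uz2') /=; lia.
  rewrite mul0n addn0; case: (boolP (w \in z1)) => wz1 /=.
    have lt_w : (index w z1 < i)%N by rewrite -z1i index_mem.
    by rewrite ltnS (ltnW lt_w) leq_mul2r addnC leqnn orbT.
  case: (w \in z2); first by rewrite leq_mul2r; apply/orP; right; lia.
  by case: ltnP => // lt; rewrite -[in X in (_ <= _ + X)%N](ltn_predK lt) mulSn addnA.
move=> w; rewrite /partial_bound; case: eqP => [->|nwu].
  by rewrite uz idx_u ltnn ltnSn; lia.
case: ifP => wz; last by lia.
have nwi : index w z != i.
  by apply/eqP => wi; apply: nwu; rewrite -(nth_index x0 wz) wi.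
by rewrite ltnS [in X in (_ <= X)%N]leq_eqVlt (negPf nwi) mul0n addn0.
Qed.

(** Outer induction on the number of columns, inner on the exponents. A live row with positive
    exponent is split along x_j: it dies or loses one x_j. When all live exponents are 0,
    [spans_columns] applies. *)
Lemma staircase_spans A z c e : is_ideal A -> staircase_data A z c e ->
  spans A (staircase_bound z c e).
Proof.
elim: {z}_.+1 {-2}z (ltnSn (size z)) A c e => // N IHN z ltz.
pose dead c e v := (c v == 0)%N && (e v == 1)%N.
(* A dead row carries exponent 1; counting it as 0 makes the weight drop when a row of exponent 1 is
   killed. *)
pose weight c e := (\sum_(v | v \notin z) if dead c e v then 0 else (e v).+1)%N.
move=> A c e; elim: {c e}_.+1 {-2}c {-2}e (ltnSn (weight c e)) A => // k IHk c e ltk.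
move=> A idA SD.
have weight_upd j cj ej : j \notin z -> ~~ dead c e j ->
    ((if (cj == 0) && (ej == 1) then 0 else ej.+1) < (e j).+1)%N ->
  (weight (upd c j cj) (upd e j ej) < k)%N.
  move=> jz nd lt; rewrite -ltnS; apply: leq_trans ltk; rewrite ltnS.
  rewrite /weight (bigD1 j) //= [in X in (_ <= X)%N](bigD1 j) //= (negPf nd).
  rewrite {1}/dead {1 2 3}/upd eqxx.
  rewrite [X in (_ + X < _)%N](eq_bigr (fun v => if dead c e v then 0 else (e v).+1)%N).
    by rewrite ltn_add2r.
  by move=> v /andP[_ /negPf nvj]; rewrite /dead /upd nvj.
have [/existsP[j /and3P[jz nd ej]]|none] :=
    boolP [exists j, [&& j \notin z, ~~ dead c e j & (0 < e j)%N]].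
  have Aj := sd_rel SD jz.
  apply: (spans_split (v := j) (d0 := staircase_bound z (upd c j 0) (upd e j 1))
     (d1 := staircase_bound z (upd c j (c j)) (upd e j (e j).-1))) => // [||w|w].
  - apply: IHk; [exact: weight_upd | exact: add_gen_ideal |].
    apply: (sd_upd _ SD) => // [p|]; first exact: add_genS.
    by rewrite take0 big_nil mulr1 expr1; exact: add_gen_mem.
  - apply: IHk; [|exact: colon_ideal|].
      apply: weight_upd => //; move: nd; rewrite /dead; case: (c j) => [|?] /=.
        by case: (e j) ej => [|[|[|?]]].
      by rewrite prednK.
    apply: (sd_upd _ SD) => // [p||]; first exact: colonS.
      exact: sd_size SD _ jz.
    by rewrite /colon mulrA -exprS prednK.
  - rewrite /staircase_bound /upd; case: ifP => // _; case: eqP => // ->.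
    by rewrite mul0n addn0; lia.
  rewrite /staircase_bound /upd; case: (eqVneq w j) => [->|_].
    by rewrite (negPf jz); lia.
  by rewrite addn0.
have e0 v : v \notin z -> ~~ dead c e v -> e v = 0%N.
  move=> vz nd; move/existsPn/(_ v): none; rewrite vz nd /= -leqNgt leqn0.
  by move/eqP.
pose B := [set v | (v \in z) || ~~ dead c e v].
have AB v : v \notin B -> A 'X_v.
  rewrite inE negb_or negbK => /andP[vz /andP[/eqP cv /eqP ev]].
  by have := sd_rel SD vz; rewrite cv ev take0 big_nil mulr1 expr1.
have [B0|] := posnP #|B|.
  apply: spans_exp => // v; have vB : v \notin B by rewrite (cards0_eq B0) inE.
  have := AB _ vB; move: vB; rewrite inE negb_or negbK /staircase_bound.
  by case/andP=> /negPf-> /andP[/eqP-> /eqP->]; rewrite mul0n addn0 expr1.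
move=> B0; have := spans_columns idA SD B0 AB _ (leqnn _) idA.
move=> H; apply: (@spansW _ _ _ (partial_bound z c e (size z))).
  move=> v; rewrite /partial_bound /staircase_bound; case: ifP => // vz.
  by rewrite index_mem vz addn1.
apply: H => // [A' z' c' e' lt'|]; first by apply: IHN; exact: leq_trans lt' _.
(* Termwise membership: a column annihilates its own product, and the full product of a live row is
   a multiple of its relation. *)
rewrite take_size; apply: ideal_sum => // v; rewrite inE => vB.
have [vz|vz] := boolP (v \in z).
  rewrite (big_rem v) //= subrr mul0r; exact: ideal0.
rewrite (negPf vz) /= in vB; have := sd_rel SD vz.
rewrite (e0 _ vz vB) expr0 mul1r -{2}(cat_take_drop (c v) z) big_cat /=.
exact: ideal_mulr.
Qed.

End StaircaseSpans.

(** * The J-staircase *)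

Section JStaircase.
Variables (n r : nat) (F : fieldType).
Hypotheses (r_gt0 : (0 < r)%N) (char0 : forall k, k.+1%:R != 0 :> F).
Local Notation R := {mpoly F[n]}.
Local Notation Y v := ('X_v ^+ r : R).
Implicit Types (J : {set 'I_n}) (A : R -> Prop).

Definition below J (v : 'I_n) := [set u in ~: J | (u < v)%N].

(** Exclusive bounds, one more than the entries of [staircase]; a negative entry, possible only for
    r = 1, becomes an empty box. *)
Definition stair J : 'I_n -> nat :=
  staircase_bound r (enum (~: J)) (fun v => #|below J v|) (fun=> r.-1).

Definition stair_prod J : R := \prod_(j in J) ('X_j * \prod_(i < n | (j < i)%N) (Y j - Y i)).

Lemma stairP J (m : 'X_{1..n}) v :
  reflect ((m v)%:Z <= staircase r J v) (m v < stair J v)%N.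
Proof.
rewrite /stair /staircase_bound mem_enum inE.
have [vJ|vJ] /= := boolP (v \in J).
  rewrite /staircase vJ -/(below J v) mulSn; move: (#|_| * r)%N => t.
  by apply: (iffP idP); move: r_gt0; lia.
have vz : v \in enum (~: J) by rewrite mem_enum inE.
have -> : staircase r J v = ((index v (enum (~: J))).+1 * r)%N%:Z - 1.
  by rewrite -{1}(nth_index v vz) staircase_notin ?index_mem.
have : (0 < (index v (enum (~: J))).+1 * r)%N by rewrite muln_gt0.
by move: ((index _ _).+1 * r)%N => t; move=> ?; apply: (iffP idP); lia.
Qed.

Lemma take_below J (v : 'I_n) : take #|below J v| (enum (~: J)) = [seq u : 'I_n <- enum (~: J) | (u < v)%N].
Proof.
have -> : #|below J v| = count (fun u : 'I_n => (u < v)%N) (enum (~: J)).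
  by rewrite -sum1_card -sum1_count big_enum_cond /=; apply: eq_bigl => u; rewrite inE.
have : sorted (fun i j : 'I_n => (i < j)%N) (enum (~: J)).
  have := iota_ltn_sorted 0 n; rewrite -val_enum_ord sorted_map => so.
  by rewrite /enum_mem; apply: sorted_filter => //; [move=> ? ? ?; exact: ltn_trans | rewrite -enumT].
elim: (enum _) => //= u s IHs us; have so := path_sorted us.
case: ltnP => [_|vu]; first by rewrite add1n /= IHs.
rewrite add0n -IHs // (_ : count _ s = 0%N) ?take0 //.
apply/eqP; rewrite -leqn0 leqNgt -has_count; apply/hasPn => x xs.
have /(order_path_min _)/allP/(_ _ xs) : path (fun i j : 'I_n => (i < j)%N) u s by [].
by move=> /(_ (fun _ _ _ => @ltn_trans _ _ _)) ux; rewrite -leqNgt (leq_trans vu) // ltnW.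
Qed.

Lemma stair_spans J A : is_ideal A -> psums r A (fun=> 1%N) ->
    (forall j, j \in J -> A ('X_j ^+ r.-1 * \prod_(u in below J j) (Y j - Y u))) ->
  spans A (stair J).
Proof.
move=> idA As Aj; apply: (staircase_spans r_gt0 char0 idA); split=> //.
- exact: enum_uniq.
- move=> v _; rewrite -cardE; apply: subset_leq_card.
  by apply/subsetP => u; rewrite inE => /andP[].
move=> v; rewrite mem_enum inE negbK => vJ; rewrite take_below big_filter big_enum_cond /=.
by move: (Aj v vJ); congr (A (_ * _)); apply: eq_bigl => u; rewrite inE.
Qed.

(** The product f_J is [root_prod] with one x_j and all i > j in T j. The remaining relations are
    those of [stair_spans], and [root_dim] is the size of the box, so the bounds meet. *)
Lemma coinv_ideal_stair J p :
  in_box (stair J) p -> coinv_ideal r (stair_prod J * p) -> p = 0.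
Proof.
pose k (_ : 'I_n) := 1%N; pose T (j : 'I_n) := [set i : 'I_n | (j < i)%N].
have D : root_data r J k T.
  by move=> j jJ; split=> //; [rewrite inE ltnn | move=> l _; rewrite inE].
have TB j : j \in J -> ~: J :\: T j = below J j.
  move=> jJ; apply/setP => i; rewrite !inE -leqNgt leq_eqVlt andbC.
  by case: (boolP (i \in J)) => //= iJ; case: eqP => // /val_inj ij; rewrite ij jJ in iJ.
have prodE : root_prod r F J k T = stair_prod J.
  apply: eq_bigr => j _; rewrite expr1; congr (_ * _).
  by apply: eq_bigl => i; rewrite inE.
have idA := colon_ideal (coinv_ideal_ideal n r F) (stair_prod J).
have spA : spans (colon (coinv_ideal (F := F) r) (stair_prod J)) (stair J).
  apply: stair_spans => // [|j jJ].
    by apply: psumsS (coinv_ideal_psums r_gt0 char0) => q; apply: colonS; exact: coinv_ideal_ideal.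
  have := root_prod_row r_gt0 char0 D jJ; rewrite prodE TB //.
  by rewrite /k subn1.
apply: (in_box_free idA _ spA).
have := root_freeP r_gt0 char0 D; rewrite /root_free prodE; congr free_mod.
rewrite /root_dim [RHS](bigID (mem J)) /=; congr (_ * _)%N.
  apply: eq_bigr => j jJ; rewrite TB // /stair /staircase_bound mem_enum inE jJ /=.
  by rewrite subn1 mulnC.
have -> : (\prod_(i | i \notin J) stair J i = \prod_(i <- enum (~: J)) stair J i)%N.
  by rewrite big_enum /=; apply: eq_bigl => i; rewrite inE.
rewrite fact_exp_prod cardE.
case Ez: (enum (~: J)) => [|x0 z0]; first by rewrite big_ord0 big_nil.
rewrite -Ez (big_nth x0) big_mkord; apply: eq_bigr => i _.
by rewrite /stair /staircase_bound mem_nth // index_uniq // enum_uniq.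
Qed.

End JStaircase.

(** * Substitutions of the exterior generators *)

Section ThetaSubstitution.
Variables (n : nat) (F : fieldType) (M : 'I_n -> 'I_n -> {mpoly F[n]}).
Local Notation R := {mpoly F[n]}.
Local Notation Omega := (superspace n F).
Implicit Types (f g : Omega) (p q : R) (J K L : {set 'I_n}).

Definition theta_row k : Omega := \sum_j ss_poly (M k j) * ss_theta F j.

Definition theta_subst f : Omega :=
  \sum_(J : {set 'I_n}) ss_poly (f J) * \prod_(k <- enum J) theta_row k.

Lemma poly_theta_mul p q f g :
  (ss_poly p * f) * (ss_poly q * g) = ss_poly (p * q) * (f * g).
Proof. by rewrite rmorphM /= -!mulrA; congr (_ * _); rewrite !mulrA ss_poly_comm. Qed.

Lemma theta_rowC i j : theta_row i * theta_row j = - (theta_row j * theta_row i).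
Proof.
rewrite /theta_row mulr_suml [in RHS]mulr_sumr -sumrN.
apply: eq_bigr => k _; rewrite mulr_sumr mulr_suml -sumrN.
apply: eq_bigr => l _; rewrite !poly_theta_mul ss_thetaC mulrN.
by rewrite [M i k * _]mulrC.
Qed.

(** Terms with l < k cancel those with l > k, and the diagonal ones vanish. *)
Lemma theta_row_sqr i : theta_row i * theta_row i = 0.
Proof.
rewrite /theta_row mulr_suml.
under eq_bigr => k _ do rewrite mulr_sumr (bigID (fun l : 'I_n => (l < k)%N)) /=.
rewrite big_split /= [X in _ + X](_ : _ =
  - \sum_(k < n) \sum_(l < n | (l < k)%N)
      ss_poly (M i k) * ss_theta F k * (ss_poly (M i l) * ss_theta F l)) ?subrr //.
rewrite -sumrN; under [RHS]eq_bigr => k _ do rewrite -sumrN.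
rewrite [RHS](exchange_big_dep predT) //=; apply: eq_bigr => k _.
rewrite (bigD1 k) /= ?ltnn // poly_theta_mul ss_theta_sqr mulr0 add0r.
apply: eq_big => [l|l _]; first by rewrite -leqNgt ltn_neqAle andbC eq_sym.
by rewrite !poly_theta_mul [in RHS]ss_thetaC mulrN opprK [M i k * _]mulrC.
Qed.

Lemma theta_subst_linear : linear theta_subst.
Proof.
move=> c f g; rewrite /theta_subst scaler_sumr -big_split; apply: eq_bigr => J _ /=.
by rewrite !ffunE linearP /= mulrDl scalerAl.
Qed.
HB.instance Definition _ :=
  GRing.isLinear.Build F Omega Omega *:%R theta_subst theta_subst_linear.

Lemma theta_subst_poly p f : theta_subst (ss_poly p * f) = ss_poly p * theta_subst f.
Proof.
rewrite /theta_subst mulr_sumr; apply: eq_bigr => J _.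
by rewrite ss_poly_mulE rmorphM /= mulrA.
Qed.

Lemma theta_subst_thetas K : theta_subst (ss_thetas F K) = \prod_(k <- enum K) theta_row k.
Proof.
rewrite /theta_subst (bigD1 K) //= ss_thetasE ffunE eqxx mul1r.
by rewrite [X in _ + X]big1 ?addr0 // => L /negPf nLK; rewrite ffunE nLK raddf0 mul0r.
Qed.

Lemma theta_subst_theta k : theta_subst (ss_theta F k) = theta_row k.
Proof.
by have := theta_subst_thetas [set k]; rewrite /ss_thetas enum_set1 !big_seq1.
Qed.

Lemma theta_subst_monoid_morphism : monoid_morphism theta_subst.
Proof.
split=> [|f h].
  have -> : 1 = ss_thetas F set0 :> Omega by rewrite /ss_thetas enum_set0 big_nil.
  by rewrite theta_subst_thetas enum_set0 big_nil /ss_thetas enum_set0 big_nil.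
rewrite [theta_subst f]/theta_subst [theta_subst h]/theta_subst mulr_suml.
under [RHS]eq_bigr => K _ do rewrite mulr_sumr.
transitivity (\sum_(K : {set 'I_n}) \sum_(J : {set 'I_n} | K \subset J)
  ss_poly ((-1) ^+ ninv K (J :\: K) * f K * h (J :\: K))
     * \prod_(j <- enum J) theta_row j).
  rewrite [RHS](exchange_big_dep predT) //=; apply: eq_bigr => J _.
  by rewrite ss_mulE raddf_sum /= mulr_suml.
apply: eq_bigr => K _.
rewrite (reindex_onto (setU K) (fun J => J :\: K)) /=; last first.
  move=> P /subsetP KP; apply/setP=> x; have := KP x.
  by rewrite !inE; case: (x \in K) => //= ->.
rewrite big_mkcond; apply: eq_bigr => L _ /=.
rewrite subsetUl /= setDUl setDv set0U.
rewrite poly_theta_mul alt_prodM; [|exact: theta_rowC|exact: theta_row_sqr].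
rewrite disjoint_sym; case: (boolP [disjoint L & K]) => [dLK|nLK]; last first.
  by case: eqP => [/setDidPl dLK|_]; [rewrite dLK in nLK | rewrite !mulr0].
have -> : L :\: K = L by apply/setDidPl.
rewrite eqxx !rmorphM rmorph_sign /= [RHS]mulrA.
by rewrite [X in _ = X * _]commr_sign !mulrA.
Qed.
HB.instance Definition _ :=
  GRing.isMonoidMorphism.Build Omega Omega theta_subst theta_subst_monoid_morphism.

End ThetaSubstitution.

(** * Forms with coefficients in an ideal *)

Section Coefficients.
Variables (n : nat) (F : fieldType) (A : {mpoly F[n]} -> Prop) (idA : is_ideal A).
Local Notation Omega := (superspace n F).
Implicit Types (f g : Omega).

Definition coefs_in f := forall K, A (f K).

Lemma coefs_in0 : coefs_in 0.
Proof. by move=> K; rewrite ffunE; exact: ideal0. Qed.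

Lemma coefs_inD f g : coefs_in f -> coefs_in g -> coefs_in (f + g).
Proof. by move=> fA gA K; rewrite ffunE; apply: idealD; [|exact: fA|exact: gA]. Qed.

Lemma coefs_in_sum (I : Type) (s : seq I) (P : pred I) (f : I -> Omega) :
  (forall i, P i -> coefs_in (f i)) -> coefs_in (\sum_(i <- s | P i) f i).
Proof.
by move=> fA; apply: (big_ind coefs_in) => //; [exact: coefs_in0 | exact: coefs_inD].
Qed.

Lemma coefs_inMl f g : coefs_in g -> coefs_in (f * g).
Proof.
by move=> gA K; rewrite ss_mulE; apply: ideal_sum => // L _; exact: ideal_mull.
Qed.

Lemma coefs_inMr f g : coefs_in f -> coefs_in (f * g).
Proof.
move=> fA K; rewrite ss_mulE; apply: ideal_sum => // L _.
by rewrite -mulrA mulrCA; exact: ideal_mulr.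
Qed.

Lemma coefs_in_poly p : A p -> coefs_in (ss_poly p).
Proof. by move=> Ap K; rewrite ffunE; case: eqP => // _; exact: ideal0. Qed.

End Coefficients.

(** * The wreath product and its basic invariants *)

Section Wreath.
Variables (n r : nat) (F : fieldType).
Hypothesis r_gt0 : (0 < r)%N.
Local Notation R := {mpoly F[n]}.
Local Notation Omega := (superspace n F).
Implicit Types (g : 'M[F]_n) (w : 'S_n) (c : 'I_n -> F).

(** Stated for the inverse because the action is contragredient: g sends x_j to c_j x_(w j). *)
Definition monomial_inv g w c :=
  forall j i, invmx g j i = (if i == w j then c j else 0).

Lemma monomial_act_x g w c j : monomial_inv g w c -> act_x g j = c j *: 'X_(w j).
Proof.
move=> gwc; rewrite /act_x (bigD1 (w j)) //= gwc eqxx big1 ?addr0 // => i /negPf ni.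
by rewrite gwc ni scale0r.
Qed.

Lemma monomial_act_theta g w c j :
  monomial_inv g w c -> act_theta g j = c j *: ss_theta F (w j).
Proof.
move=> gwc; rewrite /act_theta (bigD1 (w j)) //= gwc eqxx big1 ?addr0 // => i /negPf ni.
by rewrite gwc ni scale0r.
Qed.

Lemma invmx_right g h : g *m h = 1%:M -> invmx g = h.
Proof.
by move=> gh; have [ug _] := mulmx1_unit gh; rewrite -[LHS]mulmx1 -gh mulKmx.
Qed.

Lemma wreath_monomial g : in_wreath r g ->
  exists w c, monomial_inv g w c /\ forall j, c j ^+ r = 1.
Proof.
case=> rows cols roots.
have /fin_all_exists[f fP] : forall i, exists j, [set j | g i j != 0] = [set j].
  by move=> i; apply/cards1P; rewrite rows.
have fE i j : (g i j != 0) = (j == f i).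
  by have /setP/(_ j) := fP i; rewrite !inE.
have f_inj : injective f.
  move=> i i' ff; have /eqP/cards1P[k /setP kP] := cols (f i).
  have := kP i; have := kP i'; rewrite !inE !fE ff eqxx.
  by move=> /esym/eqP-> /esym/eqP->.
pose w := (perm f_inj)^-1%g.
have wf i : w (f i) = i by rewrite -[f i](permE f_inj) permK.
have fw j : f (w j) = j by rewrite -[f _](permE f_inj) permKV.
exists w, (fun j => (g (w j) j)^-1); split; last first.
  by move=> j; rewrite exprVn roots ?invr1 // fE fw.
pose h : 'M[F]_n := \matrix_(j, i) if i == w j then (g (w j) j)^-1 else 0.
have gh : g *m h = 1%:M.
  apply/matrixP => i i'; rewrite !mxE (bigD1 (f i)) //= !mxE wf big1 ?addr0.
    by rewrite eq_sym; case: eqP => _; rewrite ?mulr0 // mulfV // fE.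
  by move=> j; rewrite -fE negbK => /eqP->; rewrite mul0r.
by move=> j i; rewrite (invmx_right gh) mxE.
Qed.

Lemma perm_monomial w : monomial_inv (perm_mx w)^T w (fun=> 1).
Proof.
move=> j i; rewrite (@invmx_right _ (perm_mx w)); last first.
  by rewrite tr_perm_mx -perm_mxM mulVg perm_mx1.
by rewrite !mxE eq_sym; case: eqP.
Qed.

Lemma perm_in_wreath w : in_wreath r (perm_mx w : 'M[F]_n)^T.
Proof.
have E i j : (((perm_mx w : 'M[F]_n)^T) i j != 0) = (w j == i).
  by rewrite !mxE; case: (w j == i); rewrite ?oner_eq0 ?eqxx.
split=> [i|j|i j].
- by apply/eqP/cards1P; exists (w^-1 i)%g; apply/setP => j;
    rewrite !inE E (canF_eq (permK w)).
- by apply/eqP/cards1P; exists (w j); apply/setP => i; rewrite !inE E eq_sym.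
by rewrite E !mxE => ->; rewrite expr1n.
Qed.

Lemma diag_monomial (d : 'rV[F]_n) : (forall j, d 0 j != 0) ->
  monomial_inv (diag_mx d) 1 (fun j => (d 0 j)^-1).
Proof.
move=> d0 j i; rewrite (@invmx_right _ (diag_mx (\row_j (d 0 j)^-1))).
  by rewrite !mxE perm1 [j == i]eq_sym; case: (i == j); rewrite ?mulr1n ?mulr0n.
apply/matrixP => k l; rewrite mul_diag_mx !mxE.
by case: eqP => [->|_]; rewrite ?mulr1n ?mulfV ?mulr0n ?mulr0.
Qed.

Lemma diag_in_wreath (d : 'rV[F]_n) :
  (forall j, d 0 j ^+ r = 1) -> in_wreath r (diag_mx d).
Proof.
move=> dr; have d0 j : d 0 j != 0.
  apply/eqP => dj; have /eqP := dr j.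
  by rewrite dj expr0n eqn0Ngt r_gt0 eq_sym oner_eq0.
have E i j : (diag_mx d i j != 0) = (i == j).
  by rewrite !mxE; case: (i == j); rewrite ?mulr1n ?d0 ?mulr0n ?eqxx.
split=> [i|j|i j].
- by apply/eqP/cards1P; exists i; apply/setP => j; rewrite !inE E eq_sym.
- by apply/eqP/cards1P; exists j; apply/setP => i; rewrite !inE E.
by rewrite E => /eqP->; rewrite !mxE eqxx mulr1n.
Qed.

Lemma psum_invariant k :
  positive_invariant r (ss_poly (\sum_v 'X_v ^+ (r * k.+1)) : Omega).
Proof.
split=> [g /wreath_monomial[w [c [gwc cr]]]|].
  rewrite act_poly; congr ss_poly.
  rewrite raddf_sum /= [in RHS](reindex_inj (@perm_inj _ w)) /=; apply: eq_bigr => v _.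
  rewrite rmorphXn /= comp_mpolyXU -tnth_nth tnth_mktuple (monomial_act_x _ gwc).
  by rewrite exprZn exprM cr expr1n scale1r.
rewrite ffunE eqxx linear_sum big1 //= => v _; rewrite mcoeffXn.
case: eqP => // /mnmP/(_ v); rewrite mulmnE mnm1E eqxx mnm0E mul1n.
by move/eqP; rewrite muln_eq0 orbF eqn0Ngt r_gt0.
Qed.

(** Up to the scalar r (k + 1), this is the differential of the power sum of degree r (k + 1), with
    theta_v as dx_v. *)
Lemma dpsum_invariant k :
  positive_invariant r (\sum_v ss_poly ('X_v ^+ (r * k + r.-1)) * ss_theta F v : Omega).
Proof.
split=> [g /wreath_monomial[w [c [gwc cr]]]|].
  rewrite linear_sum /= [in RHS](reindex_inj (@perm_inj _ w)) /=.
  apply: eq_bigr => v _; rewrite rmorphM /= act_poly act_thetaE -/(act_theta g v).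
  rewrite (monomial_act_theta _ gwc) rmorphXn /= comp_mpolyXU -tnth_nth tnth_mktuple.
  rewrite (monomial_act_x _ gwc) exprZn linearZ /= -scalerAl -scalerAr scalerA.
  by rewrite -exprSr -addnS prednK // -mulnSr exprM cr expr1n scale1r.
rewrite sum_ffunE linear_sum big1 //= => v _.
by rewrite ss_poly_mulE ffunE eq_sym -cards_eq0 cards1 mulr0 mcoeff0.
Qed.

End Wreath.

(** * Contraction by invariant derivations *)

Section Contraction.
Variables (n r : nat) (F : fieldType).
Hypotheses (r_gt0 : (0 < r)%N) (char0 : forall k, k.+1%:R != 0 :> F).
Variables (zeta : F) (zeta_prim : r.-primitive_root zeta).
Local Notation R := {mpoly F[n]}.
Local Notation Omega := (superspace n F).
Local Notation Y v := ('X_v ^+ r : R).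
Implicit Types (f h : Omega) (p q s : R) (J K L : {set 'I_n}).

Section CoefAct.
Variable t : n.-tuple R.

(** The group acts on coefficients alone here: after contraction the exterior generators label
    invariant derivations and are fixed. *)
Definition coef_comp f : Omega := [ffun J : {set 'I_n} => f J \mPo t].

Lemma coef_comp_linear : linear coef_comp.
Proof. by move=> c f h; apply/ffunP => J; rewrite !ffunE linearP. Qed.
HB.instance Definition _ :=
  GRing.isLinear.Build F Omega Omega *:%R coef_comp coef_comp_linear.

Lemma coef_comp_poly p : coef_comp (ss_poly p) = ss_poly (p \mPo t).
Proof. by apply/ffunP => J; rewrite !ffunE; case: eqP; rewrite ?raddf0. Qed.

Lemma coef_comp_theta j : coef_comp (ss_theta F j) = ss_theta F j.
Proof. by apply/ffunP => J; rewrite !ffunE rmorph_nat. Qed.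

Lemma coef_comp_monoid_morphism : monoid_morphism coef_comp.
Proof.
split=> [|f h]; first by rewrite -[1]/(ss_poly 1) coef_comp_poly comp_mpoly1.
apply/ffunP => J; rewrite ffunE !ss_mulE raddf_sum; apply: eq_bigr => K _ /=.
by rewrite !rmorphM rmorph_sign !ffunE.
Qed.
HB.instance Definition _ :=
  GRing.isMonoidMorphism.Build Omega Omega coef_comp coef_comp_monoid_morphism.

End CoefAct.

(* Contraction with the invariant derivations \sum_k x_k^(rd+1) d/dx_k,
   0 <= d < n, indexed by the new exterior generators theta_d. *)
Definition deriv_mx (k d : 'I_n) : R := 'X_k ^+ (r * d).+1.

(** As c_k^r = 1, both theta_k and x_k^(rd+1) acquire the factor c_k and the index w(k), so
    contraction intertwines the two actions. *)
Lemma deriv_subst_invariant g f : in_wreath r g ->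
  act g f = f ->
  coef_comp [tuple act_x g j | j < n] (theta_subst deriv_mx f) = theta_subst deriv_mx f.
Proof.
move=> /wreath_monomial[w [c [gwc cr]]] gf; rewrite -[in RHS]gf.
set t := [tuple _ | _ < _].
have rowE k : coef_comp t (theta_row deriv_mx k) = c k *: theta_row deriv_mx (w k).
  rewrite /theta_row linear_sum scaler_sumr; apply: eq_bigr => d _ /=.
  rewrite rmorphM /= coef_comp_poly coef_comp_theta scalerAl -linearZ.
  congr (ss_poly _ * _); rewrite /deriv_mx rmorphXn /= comp_mpolyXU -tnth_nth.
  rewrite tnth_mktuple (monomial_act_x _ gwc) exprZn exprS exprM cr expr1n mulr1.
  by [].
rewrite {1}/theta_subst linear_sum /act linear_sum; apply: eq_bigr => J _ /=.
rewrite rmorphM theta_subst_poly /= coef_comp_poly !rmorph_prod; congr (_ * _).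
apply: eq_bigr => k _ /=; rewrite rowE (monomial_act_theta _ gwc) linearZ /=.
by rewrite theta_subst_theta.
Qed.

Lemma mcoeff_comp_scale (c : 'I_n -> F) p m :
  (p \mPo [tuple c j *: 'X_j | j < n])@_m = p@_m * \prod_j c j ^+ m j.
Proof.
rewrite comp_mpolyEX linear_sum /= [in RHS](mpolyE p) linear_sum mulr_suml /=.
apply: eq_bigr => k _; rewrite !mcoeffZ mcoeffX -mulrA; congr (_ * _).
rewrite comp_mpolyX (eq_bigr (fun i => (c i ^+ k i)%:MP * 'X_i ^+ k i)); last first.
  by move=> i _; rewrite tnth_mktuple exprZn mul_mpolyC.
rewrite big_split /= -(rmorph_prod (@mpolyC n F)) -mpolyXE_id mul_mpolyC mcoeffZ mcoeffX mulrC.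
by case: eqP => [->|_]; rewrite ?mul1r ?mul0r.
Qed.

(** Permutation matrices make the coefficients symmetric, diagonal ones with a single entry zeta
    make the exponents divisible by r, and the constant terms vanish because each theta_k acquires a
    factor x_k; [coinv_ideal_sym] concludes. *)
Lemma deriv_subst_coef f : positive_invariant r f ->
  coefs_in (@coinv_ideal n r F) (theta_subst deriv_mx f).
Proof.
case=> f_inv f0 K; have fixK g : in_wreath r g ->
    theta_subst deriv_mx f K \mPo [tuple act_x g j | j < n] = theta_subst deriv_mx f K.
  by move=> gW; rewrite -{2}(deriv_subst_invariant gW (f_inv g gW)) ffunE.
apply: coinv_ideal_sym => //.
- apply/issymP => w; rewrite -[RHS](fixK _ (perm_in_wreath r F w)) /msym /comp_mpoly.
  rewrite /mmap; apply: eq_bigr => m _; congr (_ * _); rewrite /mmap1.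
  apply: eq_bigr => i _; rewrite tnth_mktuple.
  by rewrite (monomial_act_x _ (@perm_monomial _ _ w)) scale1r.
- move=> m; rewrite mcoeff_msupp => nz i.
  pose d := \row_j (if j == i then zeta else 1).
  have dr j : d 0 j ^+ r = 1.
    by rewrite mxE; case: eqP; rewrite ?expr1n // (prim_expr_order zeta_prim).
  have d0 j : d 0 j != 0.
    apply/eqP => dj; have /eqP := dr j.
    by rewrite dj expr0n eqn0Ngt r_gt0 eq_sym oner_eq0.
  have := congr1 (mcoeff m) (fixK _ (diag_in_wreath r_gt0 dr)).
  have -> : [tuple act_x (diag_mx d) j | j < n] =
            [tuple (d 0 j)^-1 *: 'X_j | j < n] :> n.-tuple R.
    apply: eq_mktuple => j.
    by rewrite (monomial_act_x _ (diag_monomial d0)) perm1.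
  rewrite mcoeff_comp_scale -[RHS]mulr1 => /(mulfI nz).
  rewrite (bigD1 i) //= big1 => [|j /negPf nji]; last by rewrite !mxE nji invr1 expr1n.
  rewrite !mxE eqxx mulr1 exprVn => /(congr1 GRing.inv); rewrite invrK invr1.
  by move/eqP; rewrite -(prim_order_dvd zeta_prim).
rewrite sum_ffunE linear_sum big1 // => J _ /=.
rewrite ss_poly_mulE; have [->|[k kJ]] := set_0Vmem J.
  by rewrite (rmorphM (mcoeff 0%MM)) /= f0 mul0r.
pose A0 (p : R) := p@_0%MM = 0.
have idA0 : is_ideal A0.
  split=> [|p q p0 q0|p q q0]; rewrite /A0.
  - exact: mcoeff0.
  - by rewrite mcoeffD p0 q0 addr0.
  by rewrite (rmorphM (mcoeff 0%MM)) /= q0 mulr0.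
suff : coefs_in A0 (\prod_(k <- enum J) theta_row deriv_mx k).
  by move/(_ K) => A0K; rewrite (rmorphM (mcoeff 0%MM)) /= A0K mulr0.
have: enum J != [::] by apply: contraTneq kJ => J0; rewrite -mem_enum J0.
case: (enum J) => // l e _; rewrite big_cons; apply: coefs_inMr => //.
apply: coefs_in_sum => // d _; apply: coefs_inMr => //; apply: coefs_in_poly => //.
rewrite /A0 /deriv_mx mcoeffXn; case: eqP => // /mnmP/(_ l).
by rewrite mulmnE mnm1E eqxx mnm0E mul1n.
Qed.

End Contraction.

(** * The basis theorem *)

Section Weights.
Variables (n : nat) (F : fieldType).
Local Notation R := {mpoly F[n]}.
Local Notation Omega := (superspace n F).
Implicit Types (f g : Omega) (J K L : {set 'I_n}).

Definition wt J : nat := (\sum_(j in J) j)%N.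

Lemma wt_setD K J : K \subset J -> (wt K + wt (J :\: K) = wt J)%N.
Proof. by move=> /setIidPr KJ; rewrite /wt [RHS](big_setID K) /= KJ. Qed.

Definition same_lead t f g := forall J,
  ((wt J < t)%N -> f J = 0 /\ g J = 0) /\ (wt J = t -> f J = g J).

Lemma same_leadM t1 t2 f1 g1 f2 g2 : same_lead t1 f1 g1 -> same_lead t2 f2 g2 ->
  same_lead (t1 + t2) (f1 * f2) (g1 * g2).
Proof.
move=> s1 s2 J; rewrite !ss_mulE.
have small K : K \subset J -> (wt J < t1 + t2)%N ->
    (f1 K * f2 (J :\: K) = 0) /\ (g1 K * g2 (J :\: K) = 0).
  move=> /wt_setD wK lt; have [lt1|le1] := ltnP (wt K) t1.
    by have [/(_ lt1)[-> ->] _] := s1 K; rewrite !mul0r.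
  have lt2 : (wt (J :\: K) < t2)%N by move: lt wK le1; lia.
  by have [/(_ lt2)[-> ->] _] := s2 (J :\: K); rewrite !mulr0.
split=> [lt|eq].
  by split; rewrite big1 // => K KJ; rewrite -mulrA; have [] := small K KJ lt;
    [move=> -> _ | move=> _ ->]; rewrite mulr0.
apply: eq_bigr => K /wt_setD wK; rewrite -!mulrA; congr (_ * _).
have [lt1|le1] := ltnP (wt K) t1.
  by have [/(_ lt1)[-> ->] _] := s1 K; rewrite !mul0r.
have [lt2|le2] := ltnP (wt (J :\: K)) t2.
  by have [/(_ lt2)[-> ->] _] := s2 (J :\: K); rewrite !mulr0.
have [_ ->] := s1 K; last by move: eq wK le1 le2; lia.
by have [_ ->] := s2 (J :\: K); last by move: eq wK le1 le2; lia.
Qed.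

Lemma ss_theta_mulE v f K : (ss_theta F v * f) K =
  if v \in K then (-1) ^+ ninv [set v] (K :\ v) * f (K :\ v) else 0.
Proof.
rewrite ss_mulE; case: ifP => vK.
  rewrite (bigD1 [set v]) ?sub1set //= ffunE eqxx mulr1 big1 ?addr0 //.
  by move=> L /andP[_ /negPf nL]; rewrite ffunE nL mulr0 mul0r.
rewrite big1 // => L LK; rewrite ffunE; case: eqP => [eL|_].
  by rewrite eL sub1set vK in LK.
by rewrite mulr0 mul0r.
Qed.

Lemma theta_rowE (M : 'I_n -> 'I_n -> R) k J :
  theta_row M k J = \sum_j M k j * (J == [set j])%:R.
Proof.
by rewrite /theta_row sum_ffunE; apply: eq_bigr => j _; rewrite ss_poly_mulE ffunE.
Qed.

Lemma theta_row_lead (M : 'I_n -> 'I_n -> R) (k : 'I_n) :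
    (forall j : 'I_n, (j < k)%N -> M k j = 0) ->
  same_lead k (theta_row M k) (ss_poly (M k k) * ss_theta F k).
Proof.
move=> M0 J; rewrite theta_rowE ss_poly_mulE ffunE.
have J1 j : J = [set j] -> wt J = j by move=> ->; rewrite /wt big_set1.
split=> [lt|eq].
  have nJ (j : 'I_n) : (k <= j)%N -> (J == [set j]) = false.
    by move=> kj; apply/eqP => /J1 wJ; move: lt; rewrite wJ ltnNge kj.
  split; last by rewrite nJ // mulr0.
  rewrite big1 // => j _; case: (ltnP j k) => [/M0->|/nJ->]; by rewrite ?mul0r ?mulr0.
rewrite (bigD1 k) //= big1 ?addr0 // => j njk.
case: eqP => [/J1 wJ|_]; last by rewrite mulr0.
by case/negP: njk; rewrite -val_eqE /= -wJ eq.
Qed.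

Lemma theta_rows_lead (M : 'I_n -> 'I_n -> R) K :
    (forall k j : 'I_n, (j < k)%N -> M k j = 0) ->
  same_lead (wt K) (\prod_(k <- enum K) theta_row M k)
    (ss_poly (\prod_(k in K) M k k) * ss_thetas F K).
Proof.
move=> M0; rewrite /wt /ss_thetas -!big_enum /=.
elim: (enum K) => [|k s IHs].
  by rewrite !big_nil mulr1 => J; split.
rewrite !big_cons -poly_theta_mul; apply: same_leadM => //.
by apply: theta_row_lead => j; exact: M0.
Qed.

End Weights.

(** * Triangular contraction, and reduction modulo SI *)

Section Basis.
Variables (n r : nat) (F : fieldType).
Hypotheses (r_gt0 : (0 < r)%N) (char0 : forall k, k.+1%:R != 0 :> F).
Variables (zeta : F) (zeta_prim : r.-primitive_root zeta).
Local Notation R := {mpoly F[n]}.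
Local Notation Omega := (superspace n F).
Local Notation Y v := ('X_v ^+ r : R).
Local Notation SI := (ideal_pred (@positive_invariant n r F)).
Implicit Types (f h : Omega) (p q : R) (J K L : {set 'I_n}).

(** Recombines the derivations: \sum_d x_k^(rd+1) [root_coef d j] = x_k \prod_(i > j) (y_k - y_i),
    which vanishes for k > j. *)
Definition root_coef (d j : 'I_n) : R :=
  (\prod_(i < n | (j < i)%N) ('X - (Y i)%:P))`_d.

Definition contract f := theta_subst root_coef (theta_subst (deriv_mx r F) f).

Definition tri_mx (k j : 'I_n) : R := 'X_k * \prod_(i < n | (j < i)%N) (Y k - Y i).

Lemma contract_theta k : contract (ss_theta F k) = theta_row tri_mx k.
Proof.
rewrite /contract theta_subst_theta {1}/theta_row linear_sum /=.
under eq_bigr => d _ do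
  rewrite theta_subst_poly theta_subst_theta /theta_row mulr_sumr.
rewrite exchange_big; apply: eq_bigr => j _ /=.
under eq_bigr => d _ do rewrite mulrA -rmorphM.
rewrite -mulr_suml -linear_sum; congr (ss_poly _ * _).
rewrite /tri_mx; set Q := \prod_(i < n | (j < i)%N) ('X - (Y i)%:P).
have -> : \prod_(i < n | (j < i)%N) (Y k - Y i) = Q.[Y k].
  by rewrite horner_prod; apply: eq_bigr => i _; rewrite !hornerE.
(* The roots have index above j, so the degree is below n and the derivations with d < n suffice. *)
have szQ : (size Q <= n)%N.
  rewrite /Q -big_filter size_prod_XsubC size_filter -sum1_count sum1_card -[X in (_ <= X)%N](card_ord n).
  rewrite [X in (_ <= X)%N](cardD1 j) add1n ltnS; apply: subset_leq_card.
  apply/subsetP => i; rewrite !inE andbT => ji.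
  by apply/eqP => ij; have : (j < i)%N := ji; rewrite ij ltnn.
rewrite (horner_coef_wide _ szQ) mulr_sumr; apply: eq_bigr => d _.
rewrite /deriv_mx exprS -mulrA; congr (_ * _); rewrite -/Q exprM mulrC.
by [].
Qed.

Lemma contract_thetas p K :
  contract (ss_poly p * ss_thetas F K) = ss_poly p * \prod_(k <- enum K) theta_row tri_mx k.
Proof.
rewrite /contract !theta_subst_poly /ss_thetas !rmorph_prod; congr (_ * _).
by apply: eq_bigr => k _; exact: contract_theta.
Qed.

Lemma contract_SI f : f \in SI -> coefs_in (@coinv_ideal n r F) (contract f).
Proof.
move=> /ideal_predP[t [tS ->]]; have idI := coinv_ideal_ideal n r F.
rewrite /contract (linear_sum (theta_subst (deriv_mx r F))) /=.
rewrite (linear_sum (theta_subst root_coef)) /= big_seq; apply: coefs_in_sum => // -[[a b] c] abc_t.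
have /= b_inv := tS _ abc_t; rewrite !rmorphM; apply: coefs_inMr => //; apply: coefs_inMl => //.
rewrite /theta_subst; apply: coefs_in_sum => // K _; apply: coefs_inMr => //.
apply: coefs_in_poly => //.
exact: (deriv_subst_coef r_gt0 char0 zeta_prim b_inv).
Qed.

(** By triangularity theta_K contributes nothing below its own weight, and at that weight only its
    diagonal multiple; components of f of lower weight vanish. *)
Lemma contract_lead f J : (forall K, (wt K < wt J)%N -> f K = 0) ->
  contract f J = f J * stair_prod r F J.
Proof.
move=> f0; rewrite [in LHS](superspaceE f) /contract (linear_sum (theta_subst (deriv_mx r F))) /=.
rewrite (linear_sum (theta_subst root_coef)) sum_ffunE /=.
have tri0 (k j : 'I_n) : (j < k)%N -> tri_mx k j = 0.
  by move=> jk; rewrite /tri_mx (bigD1 k) //= subrr mul0r mulr0.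
have E K : theta_subst root_coef (theta_subst (deriv_mx r F)
    (ss_poly (f K) * ss_thetas F K)) J = f K * stair_prod r F K * (J == K)%:R.
  rewrite -/(contract _) contract_thetas ss_poly_mulE -mulrA.
  have [lt|gt|eq] := ltngtP (wt J) (wt K).
  - have [/(_ lt)[-> _] _] := theta_rows_lead K tri0 J.
    by case: eqP lt => [->|_]; rewrite ?ltnn ?mulr0.
  - by rewrite f0 // !mul0r.
  have [_ /(_ eq)->] := theta_rows_lead K tri0 J.
  by rewrite ss_poly_mulE ss_thetasE ffunE.
rewrite (bigD1 J) //= E eqxx mulr1 big1 ?addr0 // => K nK.
by rewrite E eq_sym (negPf nK) mulr0.
Qed.

Lemma SI_stair f : f \in SI -> (forall J, in_box (stair r J) (f J)) -> f = 0.
Proof.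
move=> fSI fbox; apply/ffunP => J; rewrite [RHS]ffunE.
elim: {J}_.+1 {-2}J (ltnSn (wt J)) => // N IHN J ltJ.
apply: (coinv_ideal_stair r_gt0 char0 (fbox J)).
rewrite mulrC -contract_lead; first exact: contract_SI.
by move=> K ltK; apply: IHN; exact: leq_trans ltK _.
Qed.

(** The other sets of the same weight as J are included, so that a whole weight level can be reduced
    at once. *)
Definition lead_ideal J p : Prop := exists2 f, f \in SI &
  forall L, (wt L <= wt J)%N -> (ss_poly p * ss_thetas F J - f) L = 0.

Lemma lead_ideal_ideal J : is_ideal (lead_ideal J).
Proof.
split=> [|p q [f fSI fE] [h hSI hE]|p q [f fSI fE]].
- by exists 0 => [|L _]; rewrite ?rpred0 // raddf0 mul0r subr0 ffunE.
- exists (f + h) => [|L lt]; first exact: rpredD.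
  by rewrite raddfD mulrDl opprD addrACA ffunE fE // hE // addr0.
exists (ss_poly p * f) => [|L lt]; first exact: ideal_pred_mull.
by rewrite rmorphM /= -mulrA -mulrBr ss_poly_mulE fE // mulr0.
Qed.

Lemma lead_ideal_SI J p : ss_poly p * ss_thetas F J \in SI -> lead_ideal J p.
Proof. by exists (ss_poly p * ss_thetas F J) => // L _; rewrite subrr ffunE. Qed.

Lemma lead_ideal_psums J : psums r (lead_ideal J) (fun=> 1%N).
Proof.
move=> k; apply: lead_ideal_SI; apply: ideal_pred_mulr.
under eq_bigr => v _ do rewrite mulr1n.
by apply: ideal_pred_gen; exact: psum_invariant.
Qed.

Definition dpsum_roots k (s : seq 'I_n) : Omega :=
  \sum_v ss_poly ('X_v ^+ (r * k + r.-1) * \prod_(u <- s) (Y v - Y u)) * ss_theta F v.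

Lemma dpsum_roots_SI k s : dpsum_roots k s \in SI.
Proof.
elim: s k => [|u s IHs] k.
  rewrite /dpsum_roots; under eq_bigr => v _ do rewrite big_nil mulr1.
  by apply: ideal_pred_gen; exact: dpsum_invariant.
have -> : dpsum_roots k (u :: s) = dpsum_roots k.+1 s - ss_poly (Y u) * dpsum_roots k s.
  rewrite /dpsum_roots mulr_sumr -sumrB; apply: eq_bigr => v _.
  rewrite mulrA -rmorphM -mulrBl -raddfB /= big_cons; congr (ss_poly _ * _).
  have -> : 'X_v ^+ (r * k.+1 + r.-1) = Y v * 'X_v ^+ (r * k + r.-1) :> R.
    by rewrite -exprD addnA mulnS.
  by ring.
by rewrite rpredB // ideal_pred_mull.
Qed.

(** Multiply [dpsum_roots] by theta_(J - j). The terms v in J - j vanish by exteriority and those in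
    [below J j] by a root factor; v > j outside J gives a larger weight. Only v = j remains, with
    sign (-1)^N. *)
Lemma lead_ideal_row J j : j \in J ->
  lead_ideal J ('X_j ^+ r.-1 * \prod_(u in below J j) (Y j - Y u)).
Proof.
move=> jJ; pose N := ninv [set j] (J :\ j).
pose w := dpsum_roots 0 (enum (below J j)).
exists (ss_poly ((-1) ^+ N) * (w * ss_thetas F (J :\ j))) => [|L ltL].
  by apply: ideal_pred_mull; apply: ideal_pred_mulr; exact: dpsum_roots_SI.
rewrite [LHS]ffunE [X in _ + X]ffunE ss_poly_mulE ss_poly_mulE ss_thetasE ffunE /w /dpsum_roots mulr_suml sum_ffunE.
have E v : (ss_poly ('X_v ^+ (r * 0 + r.-1) * \prod_(u <- enum (below J j)) (Y v - Y u)) *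
     ss_theta F v * ss_thetas F (J :\ j)) L = if v == j then
     (-1) ^+ N * ('X_j ^+ r.-1 * \prod_(u in below J j) (Y j - Y u)) * (L == J)%:R else 0.
  rewrite -mulrA ss_poly_mulE ss_theta_mulE ss_thetasE ffunE muln0 add0n big_enum.
  case: (boolP (v \in L)) => [vL|nvL]; last first.
    by case: eqP nvL => [->|_ _]; [case: eqP => [->|_]; rewrite ?jJ //|]; rewrite !mulr0.
  have [vj|nvj] := eqVneq v j.
    rewrite vj in vL *; have [->|nLJ] := eqVneq L J; first by rewrite eqxx !mulr1 mulrC.
    rewrite (_ : (L :\ j == J :\ j) = false) ?mulr0 //.
    by apply: contraNF nLJ => /eqP LJ; rewrite -(setD1K vL) LJ setD1K.
  have [vB|nvB] := boolP (v \in below J j).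
    by rewrite (bigD1 v) //= subrr mul0r mulr0 mul0r.
  rewrite (_ : (L :\ v == J :\ j) = false) ?mulr0 //; apply/eqP => LJ.
  have vJ : v \notin J.
    by have /setP/(_ v) := LJ; rewrite !inE eqxx nvj /= => <-.
  move: ltL; rewrite /wt (big_setD1 v) // [X in (_ <= X)%N](big_setD1 j) //= LJ.
  rewrite leq_add2r => vj; move: nvB; rewrite !inE vJ /= ltn_neqAle vj andbT negbK.
  by rewrite val_eqE (negPf nvj).
rewrite (eq_bigr _ (fun v _ => E v)) -big_mkcond big_pred1_eq.
by rewrite [(-1) ^+ N * (_ * _)]mulrA -[(-1) ^+ N * _ * _]mulrA mulrA signrMK subrr.
Qed.

Lemma lead_ideal_stair J p :
  exists2 q, in_box (stair r J) q & lead_ideal J (p - q).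
Proof.
have [q [dq Aq]] := stair_spans r_gt0 char0 (lead_ideal_ideal J) (lead_ideal_psums J)
                      (@lead_ideal_row J) p.
by exists q.
Qed.

Lemma in_box0 d : in_box d (0 : R).
Proof. by move=> m; rewrite msupp0. Qed.

Lemma SI_reduce f : exists2 h : Omega, (forall J, in_box (stair r J) (h J)) & f - h \in SI.
Proof.
pose B := (\sum_(i < n) i).+1.
have ltB J : (wt J < B)%N.
  rewrite ltnS /wt big_mkcond; apply: leq_sum => i _; by case: ifP.
(* Here t counts the weight levels still to be treated: f lives in weights at least B - t, and B
   exceeds every weight. *)
suff : forall t (f : Omega), (forall J, (wt J + t < B)%N -> f J = 0) ->
    exists2 h : Omega, (forall J, in_box (stair r J) (h J)) & f - h \in SI.
  by move=> H; apply: (H B) => J; rewrite ltnNge leq_addl.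
move=> {f}; elim=> [|t IHt] f f0.
  exists 0 => [J|]; first by rewrite ffunE; exact: in_box0.
  rewrite subr0 (_ : f = 0) ?rpred0 //; apply/ffunP => J.
  by rewrite f0 ?addn0 // ffunE.
have /fin_all_exists2[q dq] := fun J => lead_ideal_stair J (f J).
move/fin_all_exists2 => [w wSI wE].
pose P := fun J => (wt J + t.+1 == B)%N.
pose h0 := \sum_(J | P J) ss_poly (q J) * ss_thetas F J.
have [|h hbox hSI] := IHt (f - h0 - \sum_(J | P J) w J).
  move=> L ltL; rewrite -addrA -opprD /h0 -big_split /=.
  rewrite ffunE [X in _ + X]ffunE sum_ffunE.
  rewrite (eq_bigr (fun J => if J == L then f L else 0)); last first.
    move=> J /eqP PJ; have := wE J L.
    have leL : (wt L <= wt J)%N by move: PJ ltL; lia.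
    move/(_ leL); rewrite raddfB mulrBl -addrA -opprD ffunE [X in _ + X]ffunE.
    move/eqP; rewrite subr_eq0 => /eqP <-; rewrite ss_poly_mulE ss_thetasE ffunE.
    by rewrite eq_sym; case: eqP => [->|_]; rewrite ?mulr1 ?mulr0.
  have [PL|nPL] := boolP (P L).
    by rewrite (bigD1 L) //= eqxx big1 ?addr0 ?subrr // => J /andP[_ /negPf->].
  rewrite big1 => [|J PJ]; last by case: eqP PJ nPL => // -> ->.
  by rewrite subr0 f0 //; move: ltL nPL; rewrite /P; lia.
exists (h + h0) => [J|].
  rewrite ffunE; apply: in_boxD => //; rewrite /h0 sum_ffunE.
  apply: (big_ind (in_box (stair r J))) => [||K _]; first exact: in_box0.
    by move=> ? ?; exact: in_boxD.
  rewrite ss_poly_mulE ss_thetasE ffunE; case: eqP => [->|_]; rewrite ?mulr1 ?mulr0 //.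
  exact: in_box0.
have -> : f - (h + h0) = (f - h0 - \sum_(J | P J) w J - h) + \sum_(J | P J) w J.
  by rewrite [RHS]addrAC subrK opprD addrA addrAC.
by apply: rpredD => //; apply: rpred_sum.
Qed.

Lemma monomial_box (f : Omega) J : superspace_monomials r f -> in_box (stair r J) (f J).
Proof.
case=> K [m [mK ->]]; rewrite ss_poly_mulE ss_thetasE ffunE.
case: eqP => [->|_]; last by rewrite mulr0; exact: in_box0.
by rewrite mulr1 => k; rewrite msuppX inE => /eqP-> v; exact/(stairP r_gt0)/mK.
Qed.

Theorem superspace_basis :
  is_basis (V := SR n r F) (@superspace_monomials n r F) (@SR_pi n r F).
Proof.
have piE (s : seq Omega) (c : Omega -> F) :
    \sum_(i <- s) c i *: SR_pi r i = SR_pi r (\sum_(i <- s) c i *: i).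
  by rewrite /SR_pi linear_sum; apply: eq_bigr => i _; rewrite linearZ.
split=> [s c us sA|v].
  rewrite piE => /eqP; rewrite ideal_pi_eq0 => sSI i si.
  have /(SI_stair sSI) s0 J : in_box (stair r J) ((\sum_(i <- s) c i *: i) J).
    rewrite sum_ffunE big_seq; apply: (big_ind (in_box (stair r J))).
    - exact: in_box0.
    - by move=> ? ?; exact: in_boxD.
    move=> f /sA fA; rewrite ffunE => m /msuppZ_le.
    exact: monomial_box.
  have [J [m [_ iE]]] := sA i si.
  (* The coefficient of x^m theta_J separates i from the other monomials. *)
  have coefE f : superspace_monomials r f -> (f J)@_m = (f == i)%:R.
    case=> K [k [_ fE]].
    have fJ : f J = 'X_[k] * (J == K)%:R by rewrite fE ss_poly_mulE ss_thetasE ffunE.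
    have iJ : i J = 'X_[m] by rewrite iE ss_poly_mulE ss_thetasE ffunE eqxx mulr1.
    rewrite fJ; have [eJK|nJK] := eqVneq J K; last first.
      rewrite mulr0 mcoeff0; case: eqP => // fi; have := congr1 (mcoeff m) iJ.
      rewrite -fi fJ (negPf nJK) mulr0 mcoeff0 mcoeffX eqxx => /eqP.
      by rewrite eq_sym oner_eq0.
    rewrite mulr1 mcoeffX; congr (_%:R : F); congr nat_of_bool.
    apply/eqP/eqP => [km|fi]; first by rewrite fE iE km eJK.
    have := congr1 (mcoeff m) iJ; rewrite -fi fJ eJK eqxx mulr1 !mcoeffX eqxx.
    by case: eqP => // _ /eqP; rewrite eq_sym oner_eq0.
  have := congr1 (fun f : Omega => (f J)@_m) s0.
  rewrite /= sum_ffunE ffunE linear_sum mcoeff0 /= (big_rem i) //= big1_seq.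
    by rewrite addr0 ffunE mcoeffZ coefE ?eqxx ?mulr1 //; exact: sA.
  move=> f /andP[_ fs]; rewrite ffunE mcoeffZ coefE; last exact/sA/(mem_rem fs).
  by case: eqP fs => [->|_]; rewrite ?mulr0 // mem_rem_uniqF.
have [h hbox hSI] := SI_reduce (ideal_repr v).
pose mon (Jm : {set 'I_n} * 'X_{1..n}) : Omega := ss_poly 'X_[Jm.2] * ss_thetas F Jm.1.
(* Coefficients must depend on the monomial itself, not on (J, m); the support of the argument
   recovers both. *)
pose c (f : Omega) : F := \sum_J \sum_(m <- msupp (f J)) (h J)@_m.
have cE J m : c (mon (J, m)) = (h J)@_m.
  rewrite /c (bigD1 J) //= ss_poly_mulE ss_thetasE ffunE eqxx mulr1 msuppX big_seq1.
  rewrite big1 ?addr0 // => K /negPf nKJ.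
  by rewrite ss_poly_mulE ss_thetasE ffunE nKJ mulr0 msupp0 big_nil.
exists [seq mon (J, m) | J <- enum {set 'I_n}, m <- msupp (h J)], c; split.
  move=> _ /allpairsPdep[J [m [_ mh ->]]]; exists J, m; split=> // p.
  exact/(stairP r_gt0)/hbox.
rewrite piE -[LHS]ideal_reprK; apply/ideal_piP.
rewrite [X in _ - X](_ : _ = h) //.
rewrite big_allpairs_dep /= [RHS](superspaceE h) big_enum /=.
apply: eq_bigr => J _; rewrite [X in ss_poly X]mpolyE linear_sum mulr_suml /=.
by apply: eq_bigr => m _; rewrite cE linearZ -scalerAl.
Qed.

End Basis.

(** X^r - 1 splits and, as r != 0 in F, is separable; r distinct r-th roots of unity include a
    primitive one. *)
Lemma closed_prim_root (F : closedFieldType) r : (r%:R != 0 :> F) ->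
  exists zeta : F, r.-primitive_root zeta.
Proof.
move=> r0; have r_gt0 : (0 < r)%N by rewrite lt0n; apply: contraNneq r0 => ->.
have [s] := closed_field_poly_normal ('X^r - 1%:P : {poly F}).
rewrite lead_coefXnsubC // scale1r => sE.
have /hasP[z _ z_prim] : has r.-primitive_root s.
  apply: has_prim_root => //.
  - apply/allP => z; rewrite -root_prod_XsubC -sE unity_rootE.
    by rewrite /root !hornerE subr_eq0.
  - by rewrite -separable_prod_XsubC -sE polyC1 separable_Xn_sub_1.
  have := congr1 (fun p : {poly F} => size p) sE.
  by rewrite size_prod_XsubC size_XnsubC // => -[->].
by exists z.
Qed.

Unset Implicit Arguments.

Theorem theorem3p21 (R : realType) (n r : nat)
    (hn : (0 < n)%N) (hr : (0 < r)%N) :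
  is_basis (V := SR n r R[i])
    (@superspace_monomials n r R[i])
    (@SR_pi n r R[i]).
Proof.
have char0 k : k.+1%:R != 0 :> R[i] by rewrite pnatr_eq0.
have [zeta zeta_prim] : exists zeta : R[i], r.-primitive_root zeta.
  by apply: closed_prim_root; rewrite pnatr_eq0 -lt0n.
exact: (superspace_basis n hr char0 zeta_prim).
Qed.
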